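(* Let $\phi=\tilde p/p$ be a bidegree $(m,n)$ rational inner function on $\mathbb{D}^2$, and let $\alpha\in\mathbb{T}$ be generic for $\phi$. Then, for every $f\in C(\mathbb{T}^2)$, the Clark measure $\sigma_\alpha$ of $\phi$ satisfies $$\int_{\mathbb{T}^2} f(\zeta)\,d\sigma_\alpha(\zeta)=\sum_{j=1}^n\int_{\mathbb{T}} f(\zeta,g_j^\alpha(\zeta))\,\frac{dm(\zeta)}{\left|\frac{\partial\phi}{\partial z_2}(\zeta,g_j^\alpha(\zeta))\right|},$$ where $g_1^\alpha,\dots,g_n^\alpha$ are the parametrizing functions of the level set $\mathcal{C}_\alpha(\phi)$.
   Context: $\mathbb{D}$ is the open unit disk and $\mathbb{T}$ the unit circle; $m$ in $dm$ is normalized Lebesgue measure on $\mathbb{T}$. Rational inner functions. A rational inner function (RIF) on $\mathbb{D}^2$ is a bounded holomorphic rational function on $\mathbb{D}^2$ whose non-tangential boundary values have modulus $1$ almost everywhere on $\mathbb{T}^2$. Here $\phi=\tilde p/p$ where $p\in\mathbb{C}[z_1,z_2]$ has no zeros in $\mathbb{D}^2$, has degree $m$ in $z_1$ and degree $n$ in $z_2$, $\tilde p(z)=z_1^m z_2^n\,\overline{p(1/\bar z_1,1/\bar z_2)}$, and $p,\tilde p$ have no common factor. Then $\phi$ is said to have bidegree $(m,n)$. Standing assumption: $m>0$ and $n>0$. A singularity of $\phi$ on $\mathbb{T}^2$ is a point where $p=\tilde p=0$; there are finitely many. Clark measures. For $\alpha\in\mathbb{T}$, $\sigma_\alpha$ is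 the unique positive Borel measure on $\mathbb{T}^2$ with $\frac{1-|\phi(z)|^2}{|\alpha-\phi(z)|^2}=\int_{\mathbb{T}^2}P_{z}(\zeta)\,d\sigma_\alpha(\zeta)$ for $z\in\mathbb{D}^2$, where $P_z(\zeta)=\prod_{j=1}^2\frac{1-|z_j|^2}{|\zeta_j-z_j|^2}$. Level sets. $\mathcal{C}_\alpha(\phi)$ is the closure of $\{\zeta\in\mathbb{T}^2:\lim_{r\to1^-}\phi(r\zeta)=\alpha\}$. Generic/exceptional values. $\alpha\in\mathbb{T}$ is exceptional if $\phi(\tau,z_2)\equiv\alpha$ or $\phi(z_1,\tau)\equiv\alpha$ for some $\tau\in\mathbb{T}$ (equivalently, one of the lines $\{\zeta_1=\tau\}$, $\{\zeta_2=\tau\}$ in $\mathbb{T}^2$ is contained in $\mathcal{C}_\alpha(\phi)$); otherwise $\alpha$ is generic. Parametrizing functions. For each $\alpha\in\mathbb{T}$ and any choice of base point $\tau_0\in\mathbb{T}$ there are functions $g_1^\alpha,\dots,g_n^\alpha:\mathbb{T}\to\mathbb{T}$, analytic on $\mathbb{T}\setminus\{\tau_0\}$, such that $\mathcal{C}_\alpha(\phi)$ is the union of the graphs $\{(\zeta,g_j^\alpha(\zeta)):\zeta\in\mathbb{T}\}$, $j=1,\dots,n$, together with a finite number (possibly zero) of vertical lines $\{\zeta_1=\tau_k\}$, $\tau_k\in\mathbb{T}$ (no vertical lines occur when $\alpha$ is generic). Such a choice is fixed. *)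

(* Defs.v *)
From HB Require Import structures.
From mathcomp Require Import all_boot all_order all_algebra.
From mathcomp Require Import all_classical all_reals all_analysis.
From mathcomp Require Import measurable_realfun.
From mathcomp Require Export complex polyXY.

Set Implicit Arguments.
Unset Strict Implicit.
Unset Printing Implicit Defensive.

Export numFieldNormedType.Exports.
Import Order.TTheory GRing.Theory Num.Theory Normc.

Local Open Scope classical_set_scope.
Local Open Scope ring_scope.
Local Open Scope complex_scope.

(* [R[i]] with the topology of its norm, as a normed module over itself, so that
   [differentiable] and [derive1] below are complex derivatives, and with its
   Borel sigma-algebra. The plane being second countable, the product
   sigma-algebra on [R[i] * R[i]] is the Borel one. *)
HB.instance Definition _ (R : rcfType) := NormedModule.copy R[i] R[i]^o.
HB.instance Definition _ (R : realType) :=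
  Measurable.copy R[i] (g_sigma_algebraType (@open R[i])).

Section Sets.
Context {R : realType}.

Definition unit_disk : set R[i] := [set z | `|z| < 1].
Definition unit_circle : set R[i] := [set z | `|z| = 1].
Definition bidisk : set (R[i] * R[i]) := unit_disk `*` unit_disk.
Definition torus : set (R[i] * R[i]) := unit_circle `*` unit_circle.

End Sets.

Section CircleMeasure.
Context {R : realType}.

Definition cis (t : R) : R[i] := cos t +i* sin t.

Lemma continuous_cis : continuous cis.
Proof.
move=> t; apply/cvgrPdist_lt => -[e e'] /=.
rewrite ltcE /= => /andP[/eqP -> e0].
have e20 : 0 < e / 2 by rewrite divr_gt0.
have /cvgrPdist_lt /(_ _ e20) ct := @continuous_cos R t.
have /cvgrPdist_lt /(_ _ e20) st := @continuous_sin R t.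
near=> s.
have cts : `|cos t - cos s| < e / 2 by near: s; exact: ct.
have sts : `|sin t - sin s| < e / 2 by near: s; exact: st.
have -> : cis t - cis s = (cos t - cos s)%:C + (sin t - sin s)%:C * 'i.
  by rewrite /cis; simpc.
apply: le_lt_trans (ler_normD _ _) _.
rewrite normrM !normc_def /= !expr0n /= expr1n addr0 add0r sqrtr1 mulr1.
rewrite !addr0 !sqrtr_sqr -rmorphD /= ltcR.
by rewrite [ltRHS](splitr e) ltrD.
Unshelve. all: by end_near. Qed.

Lemma measurable_cis : measurable_fun setT (cis : measurableTypeR R -> R[i]).
Proof.
apply: (@measurability _ _ _ _ _ _ (@open R[i])) => //.
move=> _ [U oU <-]; rewrite setTI; apply: open_measurable.
by apply: open_comp => // t _; exact: continuous_cis.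
Qed.

HB.instance Definition _ :=
  isMeasurableFun.Build _ _ _ _ (cis : measurableTypeR R -> R[i]) measurable_cis.

Let twopi_gt0 : 0 < 2 * pi :> R.
Proof. by rewrite mulr_gt0 ?pi_gt0. Qed.

(* Normalized arc length on the unit circle, as a measure on the plane: the law
   of [cis t] for [t] uniform in [[0, 2 * pi]]. *)
Definition circle_measure :=
  distribution (uniform_prob twopi_gt0) (cis : measurableTypeR R -> R[i]).
HB.instance Definition _ := Probability.on circle_measure.

End CircleMeasure.

Section ComplexIntegral.
Context {R : realType} d (T : measurableType d).
Variables (mu : {measure set T -> \bar R}) (D : set T) (f : T -> R[i]).

Definition cintegrable :=
  mu.-integrable D (fun x => (complex.Re (f x))%:E) /\
  mu.-integrable D (fun x => (complex.Im (f x))%:E).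

Definition cintegral : R[i] :=
  (\int[mu]_(x in D) complex.Re (f x)) +i* (\int[mu]_(x in D) complex.Im (f x)).

End ComplexIntegral.

Section RationalInnerFunctions.
Context {R : realType}.
Implicit Types (p : {poly {poly R[i]}}) (phi : R[i] * R[i] -> R[i]).

(* In [p : {poly {poly R[i]}}] the outer variable is [z1]: [p.[z1, z2]] is the
   value of [p], [p`_i`_j] is the coefficient of [z1 ^+ i * z2 ^+ j],
   [(size p).-1] is the degree in [z1] and [(sizeY p).-1] the degree in [z2]. *)

Definition reflection (m n : nat) p : {poly {poly R[i]}} :=
  \poly_(i < m.+1) \poly_(j < n.+1) conjc p`_(m - i)`_(n - j).

Lemma reflectionE m n p (z1 z2 : R[i]) : (size p <= m.+1)%N ->
  (sizeY p <= n.+1)%N -> z1 != 0 -> z2 != 0 ->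
  (reflection m n p).[z1, z2] =
  z1 ^+ m * z2 ^+ n * conjc p.[(conjc z1)^-1, (conjc z2)^-1].
Proof.
move=> sp sYp z10 z20.
have evE (q : {poly {poly R[i]}}) x y : (size q <= m.+1)%N ->
    (sizeY q <= n.+1)%N ->
    q.[x, y] = \sum_(i < m.+1) \sum_(j < n.+1) q`_i`_j * x ^+ i * y ^+ j.
  move=> sq sYq; rewrite (horner_coef_wide _ sq) horner_sum.
  apply: eq_bigr => i _; rewrite -polyC_exp hornerM hornerC.
  rewrite (horner_coef_wide _ (leq_trans (max_size_coefXY q i) sYq)).
  by rewrite mulr_suml; apply: eq_bigr => j _; rewrite mulrAC.
rewrite !evE//; last 2 first.
- exact: size_poly.
- apply/bigmax_leqP => i _; rewrite coef_poly; case: ifP => _.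
    exact: size_poly.
  by rewrite size_poly0.
rewrite rmorph_sum mulr_sumr (reindex_inj rev_ord_inj)/=.
apply: eq_bigr => i _; rewrite rmorph_sum mulr_sumr (reindex_inj rev_ord_inj)/=.
apply: eq_bigr => j _.
rewrite !subSS !coef_poly !ltnS !leq_subr coef_poly ltnS leq_subr.
have im : (i <= m)%N by rewrite -ltnS.
have jn : (j <= n)%N by rewrite -ltnS.
rewrite !subKn// !rmorphM !rmorphXn !fmorphV /= !conjcK.
have -> : z1 ^+ (m - i) = z1 ^+ m * z1^-1 ^+ i.
  by rewrite exprVn -expfB_cond ?(negbTE z10)//.
have -> : z2 ^+ (n - j) = z2 ^+ n * z2^-1 ^+ j.
  by rewrite exprVn -expfB_cond ?(negbTE z20)//.
by rewrite [_ * (z1 ^+ m * _)]mulrCA mulrACA.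
Qed.

Definition no_common_factor p q : Prop :=
  forall d a b, p = d * a -> q = d * b -> d \is a GRing.unit.

(* On the torus, the value of this function is meaningless at the zeros of [p]. *)
Definition rif (m n : nat) p (z : R[i] * R[i]) : R[i] :=
  (reflection m n p).[z.1, z.2] / p.[z.1, z.2].

Record bidegree_denominator (m n : nat) p : Prop := {
  denominator_neq0 : forall z, bidisk z -> p.[z.1, z.2] != 0;
  denominator_degree1 : size p = m.+1;
  denominator_degree2 : sizeY p = n.+1;
  denominator_reduced : no_common_factor p (reflection m n p) }.

Definition stolz_region (M : R) (zeta : R[i] * R[i]) : set (R[i] * R[i]) :=
  [set z | [/\ bidisk z,
               `|z.1 - zeta.1| <= M%:C * (1 - `|z.1|) &
               `|z.2 - zeta.2| <= M%:C * (1 - `|z.2|)]].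

Definition nontangential_limit phi (zeta : R[i] * R[i]) (l : R[i]) : Prop :=
  forall M : R, phi @ within (stolz_region M zeta) (nbhs zeta) --> l.

Record rational_inner phi : Prop := {
  inner_bounded : exists M : R, forall z, bidisk z -> `|phi z| <= M%:C;
  inner_holomorphic : forall z, bidisk z -> differentiable phi z;
  inner_rational : exists p q, forall z, bidisk z ->
    q.[z.1, z.2] != 0 /\ phi z = p.[z.1, z.2] / q.[z.1, z.2];
  inner_unimodular :
    {ae (circle_measure \x circle_measure)%E, forall zeta,
      exists2 l, nontangential_limit phi zeta l & `|l| = 1} }.

End RationalInnerFunctions.

Section Clark.
Context {R : realType}.
Implicit Types (phi : R[i] * R[i] -> R[i]) (alpha : R[i]).

Definition poisson (z zeta : R[i] * R[i]) : R :=
  (1 - normc z.1 ^+ 2) / normc (zeta.1 - z.1) ^+ 2 *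
  ((1 - normc z.2 ^+ 2) / normc (zeta.2 - z.2) ^+ 2).

(* Measures on the torus are measures on [R[i] * R[i]] that do not charge its
   complement. *)
Definition clark_measure phi alpha
    (sigma : {measure set (R[i] * R[i]) -> \bar R}) : Prop :=
  sigma (~` torus) = 0%E /\
  forall z, bidisk z ->
    ((1 - normc (phi z) ^+ 2) / normc (alpha - phi z) ^+ 2)%:E =
    (\int[sigma]_(zeta in torus) (poisson z zeta)%:E)%E.

Definition level_set phi alpha : set (R[i] * R[i]) :=
  closure [set zeta | torus zeta /\
    phi (r%:C * zeta.1, r%:C * zeta.2) @[r --> (1 : R)^'-] --> alpha].

Definition exceptional phi alpha : Prop :=
  exists2 tau, unit_circle tau &
    (forall w, unit_disk w -> phi (tau, w) = alpha) \/
    (forall w, unit_disk w -> phi (w, tau) = alpha).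

Definition generic phi alpha : Prop := ~ exceptional phi alpha.

(* Real-analyticity along the circle, as a power series in the ambient complex
   variable. *)
Definition circle_analytic_at (h : R[i] -> R[i]) (tau : R[i]) : Prop :=
  exists (a : nat -> R[i]) (r : R), 0 < r /\
    forall zeta, unit_circle zeta -> `|zeta - tau| < r%:C ->
      series (fun k => a k * (zeta - tau) ^+ k) @ \oo --> h zeta.

Record parametrization phi alpha (n : nat) (tau0 : R[i])
    (g : 'I_n -> R[i] -> R[i]) : Prop := {
  param_base : unit_circle tau0;
  param_circle : forall j zeta, unit_circle zeta -> unit_circle (g j zeta);
  param_analytic : forall j tau, unit_circle tau -> tau != tau0 ->
    circle_analytic_at (g j) tau;
  param_level_set : exists2 S : set R[i], finite_set S /\ S `<=` unit_circle &
    level_set phi alpha =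
      [set zeta | unit_circle zeta.1 /\ exists j, zeta.2 = g j zeta.1] `|`
      (S `*` unit_circle) }.

Definition dz2 phi (z : R[i] * R[i]) : R[i] :=
  derive1 (fun w : R[i] => phi (z.1, w)) z.2.

End Clark.

(* Main.v *)
Require Import Defs.
From mathcomp Require Import all_boot all_order all_algebra.
From mathcomp Require Import all_classical all_reals all_analysis.
From mathcomp Require separable.
From mathcomp Require Import measurable_realfun zify ring lra.

Set Implicit Arguments.
Unset Strict Implicit.
Unset Printing Implicit Defensive.

Import Order.TTheory GRing.Theory Num.Theory Normc.
Local Open Scope classical_set_scope.
Local Open Scope ring_scope.
Local Open Scope complex_scope.

(* For [zeta] on the circle outside a finite set, [phi (zeta, _)] is a finite
   Blaschke product of degree [n]; expanding [(alpha + phi) / (alpha - phi)] in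
   partial fractions writes its real part as the sum over the [n] solutions [a]
   of [phi (zeta, a) = alpha] of [P_w(a) / |d phi / d z2|]. For fixed [w] in the
   disk, genericity makes [(alpha + phi (z, w)) / (alpha - phi (z, w))] a
   rational function of [z] without poles on the closed disk, hence the Poisson
   integral of its boundary values. So both sides of the formula agree on all
   products of Poisson kernels, and finite combinations of these are uniformly
   dense in the continuous functions on the torus. *)

(** * Complex numbers and the Poisson kernel *)

(** The singularities of [phi] lie on the torus, where neither the quotient nor the branches are
    under control. The Poisson formula is therefore applied in [z] only, with [w] strictly inside
    the disk: there [p] has no zero for [|z| <= 1], by a quantitative form of Hurwitz's theorem, and
    [alpha p - refl] has none either, by genericity for [|z| = 1] and by the defining property of
    [sigma] for [|z| < 1]. The excluded [z] come from a resultant: on the torus a zero of [p] is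
    also one of its reflection, and coprimality leaves finitely many. Together with the vertical
    lines and the base point they form a null set. The Poisson formula is needed for rational
    functions only, so a geometric expansion of [1 / (1 - c z)] replaces the Cauchy integral. The
    weights could a priori blow up near a singularity; setting [w = 0] in the slice formula turns
    every kernel into [1] and bounds each weight by a function continuous on the circle. The
    approximating kernels are discrete from the start, so that no integral has to be discretized. *)

Section ComplexNumbers.
Context {R : rcfType}.
Implicit Types (a b z w : R[i]) (s : seq R[i]) (q : {poly R[i]}).

Lemma conjcD z w : conjc (z + w) = conjc z + conjc w.
Proof. exact: rmorphD. Qed.

Lemma conjcB z w : conjc (z - w) = conjc z - conjc w.
Proof. exact: rmorphB. Qed.

Lemma conjcM z w : conjc (z * w) = conjc z * conjc w.
Proof. exact: rmorphM. Qed.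

Lemma conjcV z : conjc z^-1 = (conjc z)^-1.
Proof. exact: fmorphV. Qed.

Lemma conjcX z k : conjc (z ^+ k) = conjc z ^+ k.
Proof. exact: rmorphXn. Qed.

Lemma normCE z : `|z| = (normc z)%:C.
Proof. by case: z. Qed.

Lemma normc_ge0 z : 0 <= normc z.
Proof. by case: z => x y; rewrite /= sqrtr_ge0. Qed.

Lemma normc_eq0 z : (normc z == 0) = (z == 0).
Proof. by apply/eqP/eqP => [/eq0_normc|->]; rewrite ?normc0. Qed.

Lemma normc_gt0 z : (0 < normc z) = (z != 0).
Proof. by rewrite lt_def normc_ge0 normc_eq0 andbT. Qed.

Lemma sqr_normcJ z : (normc z ^+ 2)%:C = z * conjc z.
Proof. by rewrite rmorphXn /= -normCE sqr_normc. Qed.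

Lemma normcJc z : normc (conjc z) = normc z.
Proof. by case: z => x y /=; rewrite sqrrN. Qed.

Lemma normcX z k : normc (z ^+ k) = normc z ^+ k.
Proof. by elim: k => [|k IH]; rewrite ?expr0 ?normc1// !exprS normcM IH. Qed.

Lemma normcB z w : normc (z - w) = normc (w - z).
Proof. by rewrite -normcN opprB. Qed.

Lemma normcRC (x : R) : normc x%:C = `|x|.
Proof. by rewrite /= expr0n addr0 sqrtr_sqr. Qed.

Lemma le_normc_sub z w : normc z - normc w <= normc (z - w).
Proof. by rewrite lerBlDr -{1}(subrK w z); exact: le_normcD. Qed.

Lemma le_Re_normc z : `|complex.Re z| <= normc z.
Proof. by have := normc_ge_Re z; rewrite normCE lecR. Qed.

Lemma le_Im_normc z : `|complex.Im z| <= normc z.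
Proof.
case: z => x y /=; rewrite -sqrtr_sqr ler_wsqrtr// lerDr; exact: sqr_ge0.
Qed.

Lemma normc_le_ReIm z : normc z <= `|complex.Re z| + `|complex.Im z|.
Proof.
rewrite {1}[z]complexE (le_trans (le_normcD _ _))// normcM !normcRC.
by rewrite lerD2l /= expr0n expr1n add0r sqrtr1 mul1r.
Qed.

Lemma conjc_unit z : normc z = 1 -> conjc z = z^-1.
Proof.
move=> z1; have zz : z * conjc z = 1 by rewrite -sqr_normcJ z1 expr1n.
have z0 : z != 0 by rewrite -normc_gt0 z1 ltr01.
by apply: (mulfI z0); rewrite zz divff.
Qed.

Lemma unitc_neq0 z : normc z = 1 -> z != 0.
Proof. by move=> z1; rewrite -normc_gt0 z1 ltr01. Qed.

Lemma normc_eq1 z : (normc z = 1) <-> (`|z| = 1).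
Proof.
rewrite normCE; split=> [->//|]; rewrite -[1 in RHS]/((1 : R)%:C).
exact: complexI.
Qed.

Lemma normc_lt1 z : (normc z < 1) = (`|z| < 1).
Proof. by rewrite normCE -ltcR. Qed.

(** One-variable factor of [poisson]. The point [z] may also lie outside the disk; the kernel is
    then negative on the circle, and this gives [clark_weight] its sign. *)
Definition pker z w : R := (1 - normc z ^+ 2) / normc (w - z) ^+ 2.

Lemma pker_ge0 z w : normc z < 1 -> 0 <= pker z w.
Proof.
move=> z1; rewrite divr_ge0// ?sqr_ge0// subr_ge0 expr_le1 ?normc_ge0//.
exact: ltW.
Qed.

Lemma Re_cayley z w : complex.Re ((z + w) / (z - w)) =
  (normc z ^+ 2 - normc w ^+ 2) / normc (z - w) ^+ 2.
Proof.
have [->|zw] := eqVneq z w; first by rewrite !subrr invr0 mulr0 mul0r.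
apply: complexI; rewrite ReJ_add.
have zw0 : z - w != 0 by rewrite subr_eq0.
have zw0' : conjc z - conjc w != 0 by rewrite -conjcB conjc_eq0.
have -> (x y u : R) : ((x - y) / u)%:C = (x%:C - y%:C) / u%:C.
  by rewrite fmorph_div rmorphB.
rewrite !sqr_normcJ conjcM conjcV !conjcB conjcD.
by field; rewrite zw0 zw0'.
Qed.

Lemma pker_Re a b : normc a = 1 -> pker b a = complex.Re ((a + b) / (a - b)).
Proof. by move=> a1; rewrite Re_cayley a1 expr1n. Qed.

Lemma normc_blaschke a w : normc (1 - conjc a * w) ^+ 2 =
  normc (w - a) ^+ 2 - (normc a ^+ 2 - 1) * (1 - normc w ^+ 2).
Proof.
have E (x y u : R) : (x - (y - 1) * (1 - u))%:C =
  x%:C - (y%:C - 1) * (1 - u%:C).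
  by rewrite rmorphB rmorphM !rmorphB rmorph1.
apply: complexI; rewrite E !sqr_normcJ !(conjcB, conjcM) conjcK conjc1; ring.
Qed.

Lemma normc_blaschke_le a w : 1 <= normc a -> normc w <= 1 ->
  normc (1 - conjc a * w) <= normc (w - a).
Proof.
move=> a1 w1; rewrite -(ler_pXn2r (n := 2))// ?nnegrE ?normc_ge0//.
rewrite normc_blaschke gerBl mulr_ge0// subr_ge0 ?expr_ge1 ?expr_le1
  ?normc_ge0//.
Qed.

Lemma normc_blaschke_lt a w : 1 < normc a -> normc w < 1 ->
  normc (1 - conjc a * w) < normc (w - a).
Proof.
move=> a1 w1; rewrite -(ltr_pXn2r (n := 2))// ?nnegrE ?normc_ge0//.
by rewrite normc_blaschke gtrBl mulr_gt0// subr_gt0 ?expr_gt1 ?expr_lt1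
  ?normc_ge0 ?ltW.
Qed.

Definition roots_poly s : {poly R[i]} := \prod_(a <- s) ('X - a%:P).

Lemma roots_polyE s w : (roots_poly s).[w] = \prod_(a <- s) (w - a).
Proof. by rewrite horner_prod; apply: eq_bigr => a _; rewrite hornerXsubC. Qed.

(** With [h = roots_poly s], [w h' / h] is the sum of the [w / (w - a)], and
    [2 w / (w - a) - 1 = (w + a) / (w - a)] has real part [pker a w] on the circle. Roots outside
    the disk give the sign of [clark_weight]; roots inside give the sum of the discrete Poisson
    kernels. *)
Lemma roots_poly_logderiv s w : normc w = 1 -> (roots_poly s).[w] != 0 ->
  2 * complex.Re (w * (roots_poly s)^`().[w] / (roots_poly s).[w])
    - (size s)%:R = \sum_(a <- s) pker a w.
Proof.
move=> w1; rewrite /roots_poly; elim: s => [|a s IH].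
  by rewrite !big_nil derivC horner0 mulr0 mul0r mulr0 subr0.
rewrite !big_cons hornerM mulf_eq0 hornerXsubC => /norP[wa0 ws0].
rewrite derivM derivXsubC mul1r hornerD !hornerM !hornerXsubC -(IH ws0) (pker_Re
  a w1).
set h := (\prod_(j <- s) _).[w] in ws0 *; set h' := (_^`()).[w].
have -> : w * (h + (w - a) * h') / ((w - a) * h) = w / (w - a) + w * h' / h.
  by field; rewrite wa0 ws0.
have -> : (w + a) / (w - a) = 2 * (w / (w - a)) - 1 by field.
rewrite raddfD raddfB /=.
have -> : forall z, complex.Re (2 * z) = 2 * complex.Re z.
  by move=> z; rewrite !mulr_natl !mulr2n raddfD.
rewrite -[(size s).+1]addn1 natrD; ring.
Qed.

Lemma exists_unitc_notin s : exists2 w, normc w = 1 & w \notin s.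
Proof.
(* Cayley transforms of the natural numbers: infinitely many points of the circle, so one of them
   escapes any finite list. *)
pose f (k : nat) : R[i] := (k%:R + 'i) / (k%:R - 'i).
have kconj k : conjc (k%:R - 'i) = k%:R + 'i :> R[i].
  rewrite -(rmorph_nat (real_complex R)); apply/eqP; rewrite eq_complex /=.
  by rewrite addr0 subr0 sub0r add0r opprK !eqxx.
have k0 k : k%:R - 'i != 0 :> R[i].
  apply/eqP => /(congr1 (@complex.Im R)); rewrite raddfB /=.
  by rewrite -[k%:R](rmorph_nat (real_complex R)) /= sub0r => /eqP;
    rewrite oppr_eq0 oner_eq0.
have f1 k : normc (f k) = 1.
  by rewrite normcM normcV -kconj normcJc divff// normc_eq0.
have finj : injective f.
  move=> k l /eqP; rewrite /f eqr_div ?k0// => /eqP kl.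
  have : (2 * 'i) * (k%:R - l%:R) = 0 :> R[i].
    by apply/eqP; rewrite -oppr_eq0; apply/eqP;
      rewrite -[RHS](subrr ((k%:R + 'i) * (l%:R - 'i))) {2}kl; ring.
  move/eqP; rewrite !mulf_eq0 pnatr_eq0 /= subr_eq0 eqr_nat.
  by rewrite eq_complex /= eqxx oner_eq0 /= => /eqP.
have [w wf ws] : exists2 w, w \in [seq f k | k <- iota 0 (size s).+1] & w \notin
  s.
  apply/allPn/negP => /allP /uniq_leq_size; rewrite map_inj_uniq// iota_uniq.
  by move=> /(_ isT); rewrite size_map size_iota ltnn.
by exists w => //; have /mapP[k _ ->] := wf.
Qed.

End ComplexNumbers.

(** * Finite Blaschke products *)

Section ConjugateReciprocal.
Context {R : rcfType}.
Implicit Types (a b w beta lambda : R[i]) (s : seq R[i]) (q : {poly R[i]}).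

(** The formal degree [n] is kept apart from the degree of [q], because the slices of [p] may drop
    in degree at special points. If [q] has no zero on the closed disk, [rev_poly n q / q] is still
    a Blaschke product of degree [n]: the missing degree becomes a zero at the origin. *)
Definition rev_poly (n : nat) q : {poly R[i]} :=
  \poly_(j < n.+1) conjc q`_(n - j).

Lemma coef_rev n q j :
  (rev_poly n q)`_j = if (j <= n)%N then conjc q`_(n - j) else 0.
Proof. by rewrite coef_poly ltnS. Qed.

Lemma size_rev n q : (size (rev_poly n q) <= n.+1)%N.
Proof. exact: size_poly. Qed.

Lemma revZ n a q : rev_poly n (a *: q) = conjc a *: rev_poly n q.
Proof.
apply/polyP => j; rewrite coefZ !coef_rev; case: ifP => _;
  last by rewrite mulr0.
by rewrite coefZ conjcM.
Qed.

Lemma rev_horner n q w : (size q <= n.+1)%N -> w != 0 ->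
  (rev_poly n q).[w] = w ^+ n * conjc q.[(conjc w)^-1].
Proof.
move=> sq w0; rewrite (horner_coef_wide _ (size_rev n q)) (horner_coef_wide _
  sq).
rewrite rmorph_sum mulr_sumr (reindex_inj rev_ord_inj)/=.
apply: eq_bigr => j _; rewrite subSS coef_rev leq_subr.
have jn : (j <= n)%N by rewrite -ltnS.
rewrite subKn// conjcM conjcX conjcV conjcK mulrCA; congr (_ * _).
by rewrite exprVn -expfB_cond// (negbTE w0).
Qed.

Lemma rev_circle n q w : (size q <= n.+1)%N -> normc w = 1 ->
  (rev_poly n q).[w] = w ^+ n * conjc q.[w].
Proof.
move=> sq w1; rewrite rev_horner ?unitc_neq0//.
by rewrite conjc_unit// invrK.
Qed.

Lemma rev_mulXsubC n q a : (size q <= n.+1)%N ->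
  rev_poly n.+1 (('X - a%:P) * q) = (1 - conjc a *: 'X) * rev_poly n q.
Proof.
move=> sq; apply/polyP => j; rewrite coef_rev mulrBl coefB coefXM coefCM.
rewrite mulrBl mul1r coefB -scalerAl coefZ coefXM.
case: j => [|j]; rewrite ?subn0 ?eqxx /= ?mulr0 !coef_rev.
  by rewrite subn0 (nth_default _ sq) mulr0 !subr0.
rewrite !ltnS subSS; case: (leqP j n) => jn; last first.
  by rewrite ltnNge (ltnW jn)/= mulr0 subr0.
rewrite subn_eq0 conjcB conjcM.
case: (ltngtP j n) jn => // [jn _|-> _].
  by rewrite subnS.
by rewrite subnn conjc0 sub0r.
Qed.

(** The coefficient at [j] carries the factor [j] on the left and [n - (n - j)] on the right. On the
    circle this gives the derivative of the Blaschke product. *)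
Lemma rev_deriv n q :
  'X * (rev_poly n q)^`() = rev_poly n q *+ n - rev_poly n ('X * q^`()).
Proof.
apply/polyP => j; rewrite coefXM coefB coefMn !coef_rev coefXM.
case: j => [|j] /=.
  rewrite subn0; case: n => [|n]; first by rewrite eqxx conjc0 mulr0n subr0.
  by rewrite coef_deriv rmorphMn subrr.
rewrite !coef_deriv coef_rev; case: ltnP => jn; last by rewrite !mul0rn subr0.
case E : (n - j.+1)%N => [|k].
  by rewrite eqxx conjc0 subr0; congr (_ *+ _); lia.
rewrite rmorphMn/= -E; apply/eqP; rewrite eq_sym subr_eq -mulrnDr; apply/eqP.
by congr (_ *+ _); lia.
Qed.

Lemma rev_poly1 n : rev_poly n 1 = 'X^n.
Proof.
apply/polyP => j; rewrite coef_rev coef1 coefXn subn_eq0.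
by case: ltngtP => // _; rewrite ?conjc0 ?conjc1.
Qed.

Lemma roots_poly_cons a s : roots_poly (a :: s) = ('X - a%:P) * roots_poly s.
Proof. exact: big_cons. Qed.

Lemma roots_poly_nil : roots_poly [::] = 1 :> {poly R[i]}.
Proof. exact: big_nil. Qed.

Lemma size_roots_poly s : size (roots_poly s) = (size s).+1.
Proof. exact: size_prod_XsubC. Qed.

(** Reversal turns each factor [w - a] into [1 - conjc a * w], which in the disk is no larger, and
    strictly smaller if [1 < normc a]. A degree deficit contributes a power of [w], again a strict
    gain. Without any gain all roots are on the circle, and each reversed factor is a unimodular
    multiple of the original. *)
Lemma rev_roots_dichotomy n s : (size s <= n)%N ->
  all (fun a => 1 <= normc a) s ->
  (forall w, normc w < 1 ->
     normc (rev_poly n (roots_poly s)).[w] < normc (roots_poly s).[w]) \/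
  [/\ n = size s, all (fun a => normc a == 1) s & exists2 lambda,
     normc lambda = 1 & rev_poly n (roots_poly s) = lambda *: roots_poly s].
Proof.
elim: s n => [|a s IH] [|n] //=.
- right; split=> //; exists 1; first exact: normc1.
  by rewrite scale1r roots_poly_nil rev_poly1 expr0.
- move=> _ _; left=> w w1; rewrite roots_poly_nil rev_poly1 hornerXn hornerE.
  by rewrite normcX normc1 exprn_ilt1 ?normc_ge0.
- rewrite ltnS => sn /andP[a1 s1].
  have H w : normc w < 1 ->
      normc (1 - conjc a * w) <= normc (w - a) /\ 0 < normc (w - a).
    move=> w1; split; first exact: normc_blaschke_le (ltW w1).
    by rewrite normc_gt0 subr_eq0; apply: contraTneq w1 => ->; rewrite -leNgt.
  have E w : (rev_poly n.+1 (roots_poly (a :: s))).[w] =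
      (1 - conjc a * w) * (rev_poly n (roots_poly s)).[w].
    rewrite roots_poly_cons rev_mulXsubC ?size_roots_poly//.
    by rewrite !hornerE.
  have E' w : (roots_poly (a :: s)).[w] = (w - a) * (roots_poly s).[w].
    by rewrite roots_poly_cons hornerM hornerXsubC.
  have [IHs|[ns s1' [lambda l1 IHs]]] := IH n sn s1.
    left=> w w1; have [H1 H2] := H w w1; rewrite E E' !normcM.
    apply: (@le_lt_trans _ _ (normc (w - a) * normc (rev_poly n (roots_poly
      s)).[w])).
      by rewrite ler_wpM2r// normc_ge0.
    by rewrite ltr_pM2l// IHs.
  have [a1'|a1'] := eqVneq (normc a) 1.
    right; split; rewrite ?ns ?s1'//; exists (- conjc a * lambda).
      by rewrite normcM normcN normcJc a1' l1 mulr1.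
    rewrite -ns roots_poly_cons rev_mulXsubC ?size_roots_poly// IHs.
    have aa : (conjc a)%:P * a%:P = 1 :> {poly R[i]}.
      have e1 : a * conjc a = 1 by rewrite -sqr_normcJ a1' expr1n.
      by rewrite -polyCM mulrC e1.
    by rewrite -!mul_polyC polyCM polyCN -[in LHS]aa; ring.
  left=> w w1; rewrite E E' !normcM IHs hornerZ normcM l1 mul1r.
  rewrite ltr_pM2r; first by apply: normc_blaschke_lt;
    rewrite // lt_neqAle eq_sym a1' a1.
  rewrite normc_gt0 roots_polyE prodf_seq_neq0; apply/allP => b bs /=.
  rewrite subr_eq0; apply: contraTneq w1 => ->; rewrite -leNgt.
  by move/allP: s1; exact.
Qed.

Lemma factor_roots q : q != 0 -> exists s,
  [/\ q = lead_coef q *: roots_poly s, (size s).+1 = size q &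
      forall a, root q a = (a \in s)].
Proof.
move=> q0; have [s qs] := closed_field_poly_normal q.
have l0 : lead_coef q != 0 by rewrite lead_coef_eq0.
exists s; split => //; first by rewrite [in RHS]qs size_scale// size_roots_poly.
by move=> a; rewrite qs rootZ// root_prod_XsubC.
Qed.

Lemma rev_dichotomy n q : q != 0 -> (size q <= n.+1)%N ->
  (forall w, normc w < 1 -> q.[w] != 0) ->
  (forall w, normc w < 1 -> normc (rev_poly n q).[w] < normc q.[w]) \/
  exists2 lambda, normc lambda = 1 & rev_poly n q = lambda *: q.
Proof.
move=> q0 sq qD; have [s [qs ss rs]] := factor_roots q0.
have s1 : all (fun a => 1 <= normc a) s.
  apply/allP => a; rewrite -rs leNgt => /rootP qa; apply/negP => /qD.
  by rewrite qa eqxx.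
have sn : (size s <= n)%N by rewrite -ltnS ss.
have l0 : lead_coef q != 0 by rewrite lead_coef_eq0.
have [H|[_ _ [lambda l1 H]]] := rev_roots_dichotomy sn s1.
  left=> w w1; rewrite qs revZ !hornerZ !normcM normcJc ltr_pM2l ?normc_gt0//.
  exact: H.
move: (lead_coef q) l0 qs => l l0 qs.
right; exists (conjc l / l * lambda).
  by rewrite !normcM normcV normcJc divff ?mul1r// normc_eq0.
rewrite [in LHS]qs revZ H [in RHS]qs !scalerA; congr (_ *: _).
by rewrite mulrAC divfK.
Qed.

(** Roots strictly outside the closed disk leave the unimodular alternative of [rev_roots_dichotomy]
    only for an empty list of roots, and then [n = size s] contradicts [0 < n]. *)
Lemma rev_lt n q w : (0 < n)%N -> (size q <= n.+1)%N ->
  (forall w, normc w <= 1 -> q.[w] != 0) -> normc w < 1 ->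
  normc (rev_poly n q).[w] < normc q.[w].
Proof.
move=> n0 sq qD w1.
have q0 : q != 0.
  apply/eqP => q0; have := qD 0; rewrite q0 horner0 eqxx normc0 ler01.
  by move=> /(_ isT).
have [s [qs ss rs]] := factor_roots q0.
have s1 : all (fun a => 1 < normc a) s.
  apply/allP => a; rewrite -rs ltNge => /rootP qa; apply/negP => /qD.
  by rewrite qa eqxx.
have s1' : all (fun a => 1 <= normc a) s.
  by apply/allP => a /(allP s1); exact: ltW.
have sn : (size s <= n)%N by rewrite -ltnS ss.
have l0 : lead_coef q != 0 by rewrite lead_coef_eq0.
have [H|[ns a1 _]] := rev_roots_dichotomy sn s1'.
  rewrite qs revZ !hornerZ !normcM normcJc ltr_pM2l ?normc_gt0//.
  exact: H.
case: s ns s1 a1 {qs ss rs s1' sn} => [n00|a s _ /andP[a1 _] /andP[/eqP a1' _]].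
  by rewrite n00 in n0.
by rewrite a1' ltxx in a1.
Qed.

End ConjugateReciprocal.

(** * Clark measures of finite Blaschke products *)

Section OneVariableClark.
Context {R : rcfType}.
Implicit Types (a b w : R[i]) (rs : seq R[i]).
Context (n : nat) (q : {poly R[i]}) (beta : R[i]).
Context (n0 : (0 < n)%N) (sq : (size q <= n.+1)%N).
Context (qD : forall w, normc w <= 1 -> q.[w] != 0) (beta1 : normc beta = 1).

Definition clark_poly : {poly R[i]} := beta *: q - rev_poly n q.
(* The modulus of the derivative of the Blaschke product [rev_poly n q / q] at a
   root of [clark_poly], see [clark_weightE]. *)
Definition clark_weight a : R :=
  n%:R - 2 * complex.Re (a * q^`().[a] / q.[a]).

Lemma clark_poly_root w : root clark_poly w -> normc w = 1.
Proof.
move=> /rootP; rewrite !hornerE => /eqP; rewrite subr_eq0 => /eqP H.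
have E : normc q.[w] = normc (rev_poly n q).[w].
  by rewrite -H normcM beta1 mul1r.
apply/eqP; rewrite eq_le; apply/andP; split; rewrite leNgt; apply/negP => w1.
  have w0 : w != 0 by rewrite -normc_gt0 (lt_trans ltr01).
  (* Reflection in the circle swaps [q] and [rev_poly n q] up to a monomial, so a root outside the
     disk is refuted by the strict inequality inside. *)
  pose v := (conjc w)^-1.
  have v1 : normc v < 1 by rewrite normcV normcJc invf_lt1 ?(lt_trans ltr01).
  have v0 : v != 0 by rewrite invr_eq0 conjc_eq0.
  have := rev_lt n0 sq qD v1; apply/negP; rewrite -leNgt.
  rewrite rev_horner// /v conjcV conjcK invrK normcM normcJc E rev_horner//.
  rewrite -/v normcM normcJc mulrA -normcM exprVn -conjcX.
  by rewrite [normc (_ * w ^+ n)]normcM normcV normcJc mulVf ?mul1r// normc_eq0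
    expf_neq0.
by have := rev_lt n0 sq qD w1; rewrite E ltxx.
Qed.

Lemma size_clark_poly : size clark_poly = n.+1.
Proof.
apply/eqP; rewrite eqn_leq; apply/andP; split.
  rewrite (leq_trans (size_polyD _ _))// geq_max size_polyN size_rev.
  by rewrite (leq_trans (size_scale_leq _ _)).
rewrite ltnNge; apply/negP => /leq_sizeP /(_ n (leqnn n)).
rewrite coefB coefZ coef_rev leqnn subnn => /eqP; rewrite subr_eq0 => /eqP H.
(* A vanishing top coefficient means that the coefficients of [q] of index [n] and [0] have equal
   moduli; at the origin the strict inequality denies it. *)
have := @rev_lt _ n q 0 n0 sq qD; rewrite normc0 ltr01 => /(_ isT).
rewrite !horner_coef0 coef_rev /= subn0 normcJc -[X in _ < X]normcJc -H normcM
  beta1.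
by rewrite mul1r ltxx.
Qed.

(** By [roots_poly_logderiv] the weight is [n - deg q] minus the sum of [pker b a] over the roots
    [b] of [q], which lie outside the closed disk, where the kernel is negative. Either such a root
    exists, or [n - deg q = n > 0]. *)
Lemma clark_weight_gt0 a : normc a = 1 -> 0 < clark_weight a.
Proof.
move=> a1; have q0 : q != 0.
  by apply/eqP => q0; have := @qD a; rewrite a1 lexx q0 horner0 eqxx =>
    /(_ isT).
have [s [qs ss rs]] := factor_roots q0.
have qa : q.[a] != 0 by rewrite qD// a1.
have sa : (roots_poly s).[a] != 0.
  by move: qa; rewrite qs hornerZ mulf_eq0 => /norP[].
have l0 : lead_coef q != 0 by rewrite lead_coef_eq0.
have s1 b : b \in s -> 1 < normc b.
  by rewrite -rs ltNge => /rootP qb; apply/negP => /qD; rewrite qb eqxx.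
rewrite /clark_weight.
have -> : a * q^`().[a] / q.[a] =
    a * (roots_poly s)^`().[a] / (roots_poly s).[a].
  move: (lead_coef q) l0 qs => l l0 ->; rewrite derivZ !hornerZ.
  by field; rewrite sa l0.
have := roots_poly_logderiv a1 sa; move/eqP; rewrite subr_eq => /eqP ->.
have pneg b : b \in s -> pker b a < 0.
  move=> /s1 b1; rewrite pmulr_llt0; last first.
    rewrite invr_gt0 exprn_gt0// normc_gt0 subr_eq0.
    by apply: contraTneq b1 => <-; rewrite a1 ltxx.
  by rewrite subr_lt0 expr_gt1// ltW// (lt_trans _ b1).
have sn : (size s <= n)%N by rewrite -ltnS ss.
have [s0|s0] := eqVneq s [::].
  by rewrite s0 big_nil add0r subr0 ltr0n.
rewrite subr_gt0; apply: (@lt_le_trans _ _ (size s)%:R);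
  last by rewrite ler_nat.
rewrite -subr_lt0 addrK.
case: s s0 pneg {qs ss rs sa s1 sn} => // b s _ pneg; rewrite big_cons.
have pb : pker b a < 0 by rewrite pneg ?mem_head.
have ps : \sum_(j <- s) pker j a <= 0.
  rewrite big_seq; elim/big_ind : _ => // [x y x0 y0|j js]; first lra.
  by rewrite ltW// pneg// inE js orbT.
lra.
Qed.

(** On the circle [rev_poly n] is [w ^+ n] times the conjugate, so [rev_deriv] brings in
    [a q'(a) / q(a)] together with its conjugate: hence the real part in [clark_weight]. As the
    weight is positive, the roots of [clark_poly] are simple. *)
Lemma clark_deriv a : root clark_poly a ->
  a * clark_poly^`().[a] = - (beta * q.[a] * (clark_weight a)%:C).
Proof.
move=> ra; have a1 := clark_poly_root ra.
have qa : q.[a] != 0 by rewrite qD// a1.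
have Ba : (rev_poly n q).[a] = beta * q.[a].
  move: ra => /rootP; rewrite !hornerE => /eqP; rewrite subr_eq0 => /eqP ->//.
have := congr1 (horner^~ a) (rev_deriv n q).
rewrite hornerM hornerX hornerD hornerN hornerMn Ba (@rev_circle _ n _ a)//;
  last first.
  have [q1|q1] := leqP (size q) 1.
    by rewrite (size1_polyC q1) derivC mulr0 size_poly0.
  rewrite (leq_trans (size_polyMleq _ _))// size_polyX /=.
  by rewrite (leq_trans _ sq)// lt_size_deriv// -size_poly_gt0 (ltn_trans _ q1).
rewrite !hornerE => H.
have E : a ^+ n * conjc q.[a] = beta * q.[a] by rewrite -Ba rev_circle.
rewrite /clark_poly derivB derivZ hornerD hornerN hornerZ mulrBr H.
have H2 : (clark_weight a)%:C =
    n%:R - (a * q^`().[a] / q.[a] + conjc (a * q^`().[a] / q.[a])).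
  by rewrite addcJ /clark_weight rmorphB rmorphM /= !rmorph_nat.
rewrite H2 conjcM conjcV.
have qa' : conjc q.[a] != 0 by rewrite conjc_eq0.
have an : a ^+ n = beta * q.[a] / conjc q.[a] by rewrite -E mulfK.
rewrite an -mulr_natl; field; rewrite qa'//.
Qed.

Lemma clark_weightE a : root clark_poly a ->
  normc (((rev_poly n q)^`().[a] * q.[a] - (rev_poly n q).[a] * q^`().[a])
    / q.[a] ^+ 2) = clark_weight a.
Proof.
move=> ra; have a1 := clark_poly_root ra.
have qa : q.[a] != 0 by rewrite qD// a1.
have Ba : (rev_poly n q).[a] = beta * q.[a].
  move: (ra) => /rootP; rewrite !hornerE => /eqP; rewrite subr_eq0 => /eqP ->//.
have a0 := unitc_neq0 a1.
have : clark_poly^`().[a] = - (beta * q.[a] * (clark_weight a)%:C) / a.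
  by rewrite -clark_deriv// mulrC mulKf.
rewrite /clark_poly derivB derivZ hornerD hornerN hornerZ => /eqP.
rewrite subr_eq => /eqP H.
have -> : (rev_poly n q)^`().[a] = beta * q^`().[a] + beta * q.[a] *
  (clark_weight a)%:C / a.
  by rewrite H; ring.
rewrite Ba.
have -> : ((beta * q^`().[a] + beta * q.[a] * (clark_weight a)%:C / a) * q.[a] -
     beta * q.[a] * q^`().[a]) / q.[a] ^+ 2 = beta * (clark_weight a)%:C / a.
  by move: (_%:C) => k; field; rewrite qa a0.
rewrite !normcM normcV a1 beta1 invr1 mulr1 mul1r normcRC ger0_norm//.
by rewrite ltW// clark_weight_gt0.
Qed.

Lemma clark_poly_neq0 : clark_poly != 0.
Proof. by rewrite -size_poly_gt0 size_clark_poly. Qed.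

Lemma clark_poly_roots : exists rs,
  [/\ uniq rs, size rs = n & forall a, root clark_poly a = (a \in rs)].
Proof.
have [rs [Brs srs rrs]] := factor_roots clark_poly_neq0.
exists rs; split=> //; last by move: srs; rewrite size_clark_poly => -[].
have l0 : lead_coef clark_poly != 0 by rewrite lead_coef_eq0 clark_poly_neq0.
rewrite -separable.separable_prod_XsubC.
rewrite separable.separable_poly.unlock; apply: Pdiv.ClosedField.root_coprimep
  => a; rewrite root_prod_XsubC -rrs => ra.
have a1 := clark_poly_root ra.
apply/eqP => P0; have B0 : clark_poly^`().[a] = 0.
  by rewrite Brs derivZ hornerZ P0 mulr0.
have := clark_deriv ra; rewrite B0 mulr0 => /eqP.
rewrite eq_sym oppr_eq0 !mulf_eq0 (negbTE (unitc_neq0 beta1)).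
rewrite (negbTE (qD _)) ?a1//= => /eqP [] k0.
by have := clark_weight_gt0 a1; rewrite k0 ltxx.
Qed.

(* Adding to [beta q + rev_poly n q] suitable multiples of the quotients of
   [clark_poly] by [X - a] cancels it at every root [a], so the sum [T] is a
   constant multiple [c] of [clark_poly]; both real parts vanish on the circle,
   whence [Re c = 0]. *)
Lemma clark_identity rs w : uniq rs -> size rs = n ->
  (forall a, root clark_poly a = (a \in rs)) -> normc w < 1 ->
  complex.Re ((beta * q.[w] + (rev_poly n q).[w]) /
              (beta * q.[w] - (rev_poly n q).[w])) =
  \sum_(a <- rs) pker w a / clark_weight a.
Proof.
move=> urs srs rrs w1.
pose B := clark_poly.
pose A := beta *: q + rev_poly n q.
pose k a := ((clark_weight a)^-1)%:C : R[i].
pose T := A + \sum_(a <- rs) k a *: (('X + a%:P) * (B %/ ('X - a%:P))).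
have divB a : a \in rs -> B = (B %/ ('X - a%:P)) * ('X - a%:P).
  by move=> ars; rewrite divpK// dvdp_XsubCl rrs.
have l0 : lead_coef B != 0 by rewrite lead_coef_eq0 clark_poly_neq0.
have BE : B = lead_coef B *: roots_poly rs.
  apply: all_roots_prod_XsubC; first by rewrite size_clark_poly srs.
    by apply/allP => a; rewrite -rrs.
  by rewrite uniq_rootsE.
have Troot a : a \in rs -> T.[a] = 0.
  move=> ars; have ra : root B a by rewrite rrs.
  have a1 := clark_poly_root ra.
  rewrite hornerD horner_sum (bigD1_seq a)//= big1_seq ?addr0.
    have Qa : (B %/ ('X - a%:P)).[a] = B^`().[a].
      rewrite [in RHS](divB _ ars) derivM derivXsubC mulr1 hornerD hornerM.
      by rewrite hornerXsubC subrr mulr0 add0r.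
    rewrite /A hornerD !hornerZ hornerM hornerD hornerX hornerC Qa.
    transitivity (beta * q.[a] + (rev_poly n q).[a] + 2 * k a * (a *
      B^`().[a])); first by ring.
    rewrite (clark_deriv ra).
    have Ba : (rev_poly n q).[a] = beta * q.[a].
      move: ra => /rootP; rewrite !hornerE => /eqP;
        rewrite subr_eq0 => /eqP ->//.
    rewrite Ba /k fmorphV; field.
    by rewrite -[0]/((0 : R)%:C) (inj_eq (@complexI R)) gt_eqF//
      clark_weight_gt0.
  move=> b /andP[ba brs]; rewrite hornerZ hornerM.
  have := congr1 (horner^~ a) (divB _ brs); rewrite hornerM hornerXsubC.
  move: ra => /rootP -> /esym/eqP; rewrite mulf_eq0 subr_eq0 [a == b]eq_sym
    (negbTE ba) orbF.
  by move=> /eqP ->; rewrite !mulr0.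
have sT : (size T <= n.+1)%N.
  rewrite (leq_trans (size_polyD _ _))// geq_max; apply/andP; split.
    rewrite (leq_trans (size_polyD _ _))// geq_max size_rev.
    by rewrite (leq_trans (size_scale_leq _ _)).
  rewrite big_seq; apply: (big_ind (fun h : {poly R[i]} => (size h <= n.+1)%N)).
  - by rewrite size_poly0.
  - by move=> x y x0 y0; rewrite (leq_trans (size_polyD _ _))// geq_max x0.
  move=> a ars; rewrite (leq_trans (size_scale_leq _ _))//.
  rewrite (leq_trans (size_polyMleq _ _))// size_XaddC.
  by rewrite size_divp ?polyXsubC_eq0// size_XsubC size_clark_poly /= subn1.
have [c TE] : exists c, T = c *: B.
  have BT : B %| T.
    rewrite BE dvdpZl//; apply: uniq_roots_dvdp; last by rewrite uniq_rootsE.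
    by apply/allP => a /Troot /rootP.
  exists (T %/ B)`_0; rewrite -mul_polyC -size1_polyC ?divpK//.
  by rewrite size_divp ?clark_poly_neq0// size_clark_poly leq_subLR addn1.
have main v : B.[v] != 0 ->
    A.[v] / B.[v] = c + \sum_(a <- rs) k a * ((a + v) / (a - v)).
  move=> Bv; apply: (mulIf Bv); rewrite divfK// mulrDl -[c * _]hornerZ -TE.
  have -> : T.[v] = A.[v] + \sum_(a <- rs) k a * ((v + a) * (B %/ ('X -
    a%:P)).[v]).
    rewrite /T hornerD horner_sum; congr (_ + _); apply: eq_bigr => a _.
    by rewrite hornerZ hornerM hornerD hornerX hornerC.
  rewrite -addrA mulr_suml -big_split/= big1_seq ?addr0// => a.
  move=> /andP[_ ars]; have := congr1 (horner^~ v) (divB _ ars).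
  rewrite hornerM hornerXsubC => E; rewrite E.
  have av : a - v != 0.
    by apply: contraNneq Bv => av; rewrite E -[v - a]opprB av oppr0 mulr0.
  by move: (k a) => ka; field.
have mainRe v : B.[v] != 0 -> complex.Re (A.[v] / B.[v]) =
    complex.Re c + \sum_(a <- rs) pker v a / clark_weight a.
  move=> Bv; rewrite main// raddfD; congr (_ + _).
  rewrite raddf_sum; apply: eq_big_seq => a; rewrite -rrs =>
    /clark_poly_root a1.
  by rewrite pker_Re// /k; case: (_ / _) => x y /=; rewrite mul0r subr0 mulrC.
have ABE v : A.[v] / B.[v] = (beta * q.[v] + (rev_poly n q).[v]) /
              (beta * q.[v] - (rev_poly n q).[v]) by rewrite !hornerE.
have c0 : complex.Re c = 0.
  have [v v1 vrs] := exists_unitc_notin rs.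
  have Bv : B.[v] != 0 by rewrite -rrs in vrs.
  have := mainRe v Bv; rewrite big1_seq ?addr0.
    rewrite ABE Re_cayley rev_circle// !normcM normcX v1 beta1 expr1n normcJc.
    by rewrite subrr mul0r.
  by move=> a _; rewrite /pker v1 expr1n subrr !mul0r.
have Bw : B.[w] != 0.
  by apply: contraTneq w1 => /rootP/clark_poly_root ->; rewrite ltxx.
by rewrite -ABE mainRe// c0 add0r.
Qed.

End OneVariableClark.

(** * Zeros of the denominator *)

Section BivariateFactors.
Context {F : closedFieldType}.
Implicit Types (c d : {poly F}) (p g a : {poly {poly F}}) (w : F).

Lemma map_eval_factor g w : map_poly (horner_eval w) g = 0 ->
  exists g1, g = ('X - w%:P) *: g1.
Proof.
move=> gw; exists (map_poly (fun c => c %/ ('X - w%:P)) g).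
apply/polyP => i; rewrite coefZ coef_map_id0 ?div0p// mulrC divpK//.
by rewrite dvdp_XsubCl; apply/rootP; rewrite -[LHS](coef_map (horner_eval w)) gw
  coef0.
Qed.

Lemma map_evalZ c g w :
  map_poly (horner_eval w) (c *: g) = c.[w] *: map_poly (horner_eval w) g.
Proof. by apply/polyP => i; rewrite coefZ !coef_map coefZ /= !horner_evalE
  hornerM. Qed.

(* Gauss's lemma: each linear factor of [c] divides [g] or [a]. *)
Lemma gauss_factor c p g a : c != 0 -> c *: p = g * a ->
  exists d g' a', g = d *: g' /\ p = g' * a'.
Proof.
move: {2}(size c) (leqnn (size c)) => k.
elim: k c g a => [|k IH] c g a.
  by rewrite leqn0 size_poly_eq0 => /eqP->; rewrite eqxx.
move=> ck c0 E; have [c1|c1] := leqP (size c) 1.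
  have cE := size1_polyC c1; have k0 : c`_0 != 0.
    by apply: contraNneq c0 => H; rewrite cE H.
  exists 1, g, ((c`_0)^-1%:P *: a); split; first by rewrite scale1r.
  by rewrite -scalerAr -E scalerA {2}cE -polyCM mulVf// scale1r.
have /closed_rootP[w] : size c != 1 by rewrite gtn_eqF.
move=> /factor_theorem[c2 cE].
have c20 : c2 != 0 by apply: contraNneq c0 => c20; rewrite cE c20 mul0r.
have Xw0 : 'X - w%:P != 0 :> {poly F} by rewrite polyXsubC_eq0.
have c2k : (size c2 <= k)%N.
  by move: ck; rewrite cE size_Mmonic ?monicXsubC// size_XsubC addn2.
have /eqP : map_poly (horner_eval w) g * map_poly (horner_eval w) a = 0.
  by rewrite -rmorphM /= -E map_evalZ cE hornerM hornerXsubC subrr mulr0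
    scale0r.
rewrite mulf_eq0 => /orP[] /eqP/map_eval_factor[h hE].
  have [] := IH c2 h a c2k c20.
    apply: (@mulfI _ ('X - w%:P)%:P); rewrite ?polyC_eq0// !mul_polyC.
    by rewrite scalerA mulrC -cE E hE scalerAl.
  move=> d [g' [a' [gE pE]]]; exists (('X - w%:P) * d), g', a'.
  by rewrite -scalerA -gE -hE.
apply: (IH c2 g h c2k c20).
apply: (@mulfI _ ('X - w%:P)%:P); rewrite ?polyC_eq0// !mul_polyC.
by rewrite scalerA mulrC -cE E hE scalerAr.
Qed.

(** A vanishing resultant yields a gcd [g] of positive degree in the outer variable, but [g] divides
    [p] and [q] only up to factors in the inner variable. Applying [gauss_factor] twice strips such
    factors off [g] without lowering its outer degree, and leaves a true common factor. *)
Lemma resultant_neq0 p (q : {poly {poly F}}) : p != 0 ->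
  (forall d a b : {poly {poly F}}, p = d * a -> q = d * b ->
    d \is a GRing.unit) ->
  resultant p q != 0.
Proof.
move=> p0 pq; apply/negP; rewrite resultant_eq0.
set g := Pdiv.Idomain.gcdp p q => sg.
have /Pdiv.WeakIdomain.dvdpP[[c a] /= c0 E] : Pdiv.Idomain.dvdp g p.
  exact: Pdiv.Idomain.dvdp_gcdl.
have /Pdiv.WeakIdomain.dvdpP[[c' b] /= c'0 E'] : Pdiv.Idomain.dvdp g q.
  exact: Pdiv.Idomain.dvdp_gcdr.
rewrite mulrC in E; rewrite mulrC in E'.
have [d [g' [a' [gE pE]]]] := gauss_factor c0 E.
have E2 : c' *: q = g' * (d *: b) by rewrite E' gE -scalerAl scalerAr.
have [d' [g'' [b' [g'E qE]]]] := gauss_factor c'0 E2.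
have pE' : p = g'' * (d' *: a') by rewrite pE g'E -scalerAl scalerAr.
have := pq _ _ _ pE' qE; rewrite poly_unitE => /andP[/eqP s1 _].
have : (size g <= size g'')%N.
  by rewrite gE g'E scalerA size_scale_leq.
by rewrite s1 leqNgt sg.
Qed.

End BivariateFactors.

Section BivariateReflection.
Context {R : realType}.
Implicit Types (z w : R[i]) (p : {poly {poly R[i]}}).

Lemma reflection_horner m n p z : (size p <= m.+1)%N -> normc z = 1 ->
  (reflection m n p).[z%:P] = z ^+ m *: rev_poly n p.[z%:P].
Proof.
move=> sp z1; have z0 := unitc_neq0 z1.
apply/polyP => j; rewrite coefZ coef_rev.
rewrite (horner_coef_wide _ (size_poly _ _)) coef_sum.
rewrite (reindex_inj rev_ord_inj)/=.
case: leqP => jn; last first.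
  rewrite mulr0 big1// => i _; rewrite -polyC_exp coefMC coef_poly;
    case: ifP => _.
    by rewrite coef_poly ltnS leqNgt jn mul0r.
  by rewrite coef0 mul0r.
rewrite (horner_coef_wide _ sp) coef_sum rmorph_sum mulr_sumr /=.
apply: eq_bigr => i _; rewrite subSS -!polyC_exp !coefMC.
have im : (i <= m)%N by rewrite -ltnS.
rewrite coef_poly ltnS leq_subr subKn// coef_poly ltnS jn.
rewrite conjcM mulrCA; congr (_ * _).
by rewrite conjcX conjc_unit// exprVn -expfB_cond// (negbTE z0).
Qed.

Lemma reflection_circle m n p z w : (size p <= m.+1)%N -> (sizeY p <= n.+1)%N ->
  normc z = 1 -> normc w = 1 ->
  (reflection m n p).[z%:P].[w] = z ^+ m * w ^+ n * conjc p.[z%:P].[w].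
Proof.
move=> sp sYp z1 w1; rewrite reflectionE ?unitc_neq0//.
by rewrite (conjc_unit z1) (conjc_unit w1) !invrK.
Qed.

End BivariateReflection.

(** * Finiteness of the zeros on the torus *)

Section Denominator.
Context {R : realType} (m n : nat) (p : {poly {poly R[i]}}).
Context (m0 : (0 < m)%N) (pm : size p = m.+1) (pn : sizeY p = n.+1).
Context (pD : forall z w, normc z < 1 -> normc w < 1 -> p.[z%:P].[w] != 0).
Context (pred : no_common_factor p (reflection m n p)).
Implicit Types z w : R[i].

(** If the slice vanished, so would its reversal, and [z1 - z] would be a common factor of [p] and
    its reflection. *)
Lemma horner_denominator_neq0 z : normc z = 1 -> p.[z%:P] != 0.
Proof.
move=> z1; apply/negP => /eqP pz.
have [a pE] : exists a, p = a * ('X - z%:P%:P) by apply/factor_theorem/rootP.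
have [b qE] : exists b, reflection m n p = b * ('X - z%:P%:P).
  apply/factor_theorem/rootP; rewrite reflection_horner ?pm// pz.
  by apply/polyP => j; rewrite coefZ coef_rev !coef0 conjc0 if_same mulr0.
rewrite mulrC in pE; rewrite mulrC in qE.
by have := pred pE qE; rewrite poly_unitE size_XsubC.
Qed.

Lemma denominator_eval_neq0 w : normc w = 1 -> map_poly (horner_eval w) p != 0.
Proof.
move=> w1; apply/negP => /eqP /[dup] pw /map_eval_factor[a pE].
have qw : map_poly (horner_eval w) (reflection m n p) = 0.
  (* The reflection formula gives zeros only at [z] on the circle; these are infinitely many, which
     is enough for a polynomial to vanish. *)
  apply/eqP/negPn/negP => q0; have [s [_ _ rs]] := factor_roots q0.
  have [z z1 zs] := exists_unitc_notin s.
  move: zs; rewrite -rs => /rootP; apply.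
  rewrite -horner_swapXY horner2_swapXY reflection_circle ?pm ?pn//.
  by rewrite -horner2_swapXY horner_swapXY pw horner0 conjc0 mulr0.
have [b qE] := map_eval_factor qw.
rewrite -mul_polyC in pE; rewrite -mul_polyC in qE.
have := pred pE qE; rewrite poly_unitE coefC eqxx poly_unitE size_XsubC.
by rewrite andbF.
Qed.

(** On the torus a zero of [p] is one of its reflection too, hence the resultant, a polynomial in
    the second variable, vanishes at [w]. For each of these finitely many [w], [z] is a root of the
    nonzero polynomial [p(., w)]. *)
Lemma torus_zeros_finite : exists E : seq R[i], forall z w,
  normc z = 1 -> normc w = 1 -> p.[z%:P].[w] = 0 -> z \in E.
Proof.
set q := reflection m n p.
have p0 : p != 0 by rewrite -size_poly_gt0 pm.
have r0 : resultant p q != 0 by exact: resultant_neq0.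
(* The extreme coefficient of the reflection is the conjugate of [p(0, 0)], nonzero since the origin
   lies in the bidisk. *)
have sq : size q = m.+1.
  apply/eqP; rewrite eqn_leq size_poly/= ltnNge; apply/negP => /leq_sizeP.
  move=> /(_ m (leqnn m)) /(congr1 (fun h : {poly R[i]} => h`_n)).
  rewrite !coef_poly !ltnS !leqnn coef_poly ltnS leqnn !subnn coef0 => /eqP.
  rewrite conjc_eq0 => /eqP p00.
  have := @pD 0 0; rewrite normc0 ltr01 => /(_ isT isT).
  by rewrite !horner_coef0 p00 eqxx.
have [[u v] _ /= ruv] : {uv : {poly {poly R[i]}} * {poly {poly R[i]}}
  | (size uv.1 < size q)%N /\ (size uv.2 < size p)%N &
  (resultant p q)%:P = uv.1 * p + uv.2 * q}.
  by apply: resultant_in_ideal; rewrite ?pm ?sq ltnS.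
have [ws [_ _ rws]] := factor_roots r0.
pose rts (h : {poly R[i]}) := sval (closed_field_poly_normal h).
exists (flatten [seq rts (map_poly (horner_eval w) p) | w <- ws]) =>
  z w z1 w1 pzw.
have qzw : q.[z%:P].[w] = 0 by rewrite reflection_circle ?pm ?pn// pzw conjc0
  mulr0.
have wr : w \in ws.
  rewrite -rws; apply/rootP.
  have := congr1 (fun h : {poly {poly R[i]}} => h.[z%:P].[w]) ruv.
  by rewrite hornerC !(hornerD, hornerM) pzw qzw !mulr0 addr0.
apply/flattenP; exists (rts (map_poly (horner_eval w) p)); first exact: map_f.
have h0 := denominator_eval_neq0 w1.
have : root (map_poly (horner_eval w) p) z.
  by apply/rootP; rewrite -horner_swapXY horner2_swapXY.
rewrite /rts; case: closed_field_poly_normal => s /= hE.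
by rewrite hE rootZ ?lead_coef_eq0// root_prod_XsubC.
Qed.

End Denominator.

(** * Topology and measurability in the plane *)

(* Typeclass search does not see through the coercion from [R : realType] to
   [rcfType] in the type of [nbhs z], hence this explicit instance. *)
#[local] Instance nbhs_complex_filter {R : realType} (z : R[i]) :
  @ProperFilter (complex (Real.sort R)) (nbhs z).
Proof. exact: nbhs_pfilter. Qed.

Section PlaneTopology.
Context {R : realType}.
Implicit Types (z w : R[i]) (p : {poly R[i]}).

Lemma nbhs_normcP z (P : set R[i]) :
  nbhs z P <-> exists2 e : R, 0 < e & forall w, normc (w - z) < e -> P w.
Proof.
split=> [/nbhs_ballP[[e e'] /=]|[e e0 eP]].
  rewrite ltcE /= => /andP[/eqP e'0 e0] eP; exists e => // w wz.
  apply: eP; rewrite -ball_normE /ball_ /= e'0.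
  by rewrite -[ltRHS]/(e%:C) normCE ltcR normcB.
apply/nbhs_ballP; exists e%:C => /=; first by rewrite ltcR.
move=> w; rewrite -ball_normE /ball_ /= normCE ltcR normcB; exact: eP.
Qed.

Lemma cvg_normcP {T : Type} {F : set_system T} {FF : Filter F} (f : T ->
  R[i]) l :
  f @ F --> l <-> (forall e : R, 0 < e -> \forall x \near F,
    normc (f x - l) < e).
Proof.
split=> [fl e e0|H].
  have : nbhs l [set w | normc (w - l) < e] by apply/nbhs_normcP; exists e.
  by move=> /fl.
move=> P /nbhs_normcP[e e0 eP]; have := H e e0; apply: filterS => x; exact: eP.
Qed.

Lemma continuous_lipschitz (f : R[i] -> R) :
  (forall z w, `|f z - f w| <= normc (z - w)) -> continuous f.
Proof.
move=> fL z; apply/cvgrPdist_lt => e e0.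
apply/nbhs_normcP; exists e => // w wz.
by rewrite (le_lt_trans (fL _ _))// normcB.
Qed.

Lemma continuous_normc : continuous (@normc R).
Proof.
apply: continuous_lipschitz => z w; rewrite ler_norml le_normc_sub andbT.
by rewrite lerNl opprB normcB le_normc_sub.
Qed.

Lemma continuous_Re : continuous (@complex.Re R).
Proof. by apply: continuous_lipschitz => z w; rewrite -raddfB le_Re_normc. Qed.

Lemma continuous_Im : continuous (@complex.Im R).
Proof. by apply: continuous_lipschitz => z w; rewrite -raddfB le_Im_normc. Qed.

Lemma continuous_RC : continuous (real_complex R).
Proof.
move=> x; apply/cvg_normcP => e e0; near=> y.
rewrite -rmorphB normcRC distrC; near: y.
by apply: (@cvgr_dist_lt _ _ _ (nbhs x) _ id x cvg_id).
Unshelve. all: by end_near. Qed.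

Lemma continuous_hornerC p : continuous (horner p).
Proof.
elim/poly_ind: p => [|p c IH] z.
  rewrite (_ : horner _ = cst 0); first exact: cvg_cst.
  by apply/funext => w /=; rewrite horner0.
rewrite (_ : horner _ = fun z => p.[z] * z + c); last first.
  by apply/funext => w; rewrite hornerD hornerM hornerX hornerC.
by apply: cvgD; [apply: cvgM; [exact: IH|exact: cvg_id]|exact: cvg_cst].
Qed.

Lemma continuous_horner2 (q : {poly {poly R[i]}}) :
  continuous (fun z : R[i] * R[i] => q.[z.1%:P].[z.2]).
Proof.
elim/poly_ind: q => [|p c IH] z.
  rewrite (_ : (fun _ => _) = cst 0); first exact: cvg_cst.
  by apply/funext => w /=; rewrite !horner0.
rewrite (_ : (fun _ => _) =
    fun z : R[i] * R[i] => p.[z.1%:P].[z.2] * z.1 + c.[z.2]); last first.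
  by apply/funext => w; rewrite !(hornerD, hornerM, hornerX, hornerC).
apply: cvgD; first by apply: cvgM; [exact: IH|exact: cvg_fst].
by apply: continuous_comp; [exact: cvg_snd|exact: continuous_hornerC].
Qed.

Lemma unit_circleE : @unit_circle R = [set z | normc z = 1].
Proof. by apply/seteqP; split=> z; rewrite /unit_circle /= => /normc_eq1. Qed.

Lemma closed_unit_circle : closed (@unit_circle R).
Proof.
rewrite unit_circleE (_ : [set _ | _] = @normc R @^-1` [set 1])//.
by apply: preimage_closed => [z _|]; [exact: continuous_normc|exact: closed_eq].
Qed.

Lemma compact_unit_circle : compact (@unit_circle R).
Proof.
pose f (x : R * R) : R[i] := x.1%:C + x.2%:C * 'i.
have fc : continuous f.
  move=> x; apply: cvgD.
    by apply: continuous_comp; [exact: cvg_fst|exact: continuous_RC].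
  apply: cvgM; last exact: cvg_cst.
  by apply: continuous_comp; [exact: cvg_snd|exact: continuous_RC].
have K : compact (f @` (`[-1, 1] `*` `[-1, 1])).
  apply: continuous_compact; first exact: continuous_subspaceT.
  by apply: compact_setX; exact: segment_compact.
apply: subclosed_compact closed_unit_circle K _ => z;
  rewrite unit_circleE /= => z1.
exists (complex.Re z, complex.Im z); last first.
  by rewrite /f /= [RHS]complexE mulrC.
by split; rewrite /= in_itv /= -ler_norml -z1 ?le_Re_normc ?le_Im_normc.
Qed.

Lemma compact_torus : compact (@torus R).
Proof. by apply: compact_setX; exact: compact_unit_circle. Qed.

End PlaneTopology.

(** * Continuity of power series along the circle *)

Section CircleAnalytic.
Context {R : realType}.
Implicit Types (z w : R[i]).

Lemma near_within_circle (tau : R[i]) (P : set R[i]) :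
  (\forall z \near within unit_circle (nbhs tau), P z) <->
  exists2 e : R, 0 < e & forall z, normc z = 1 -> normc (z - tau) < e -> P z.
Proof.
rewrite near_withinE; split=> [/nbhs_normcP[e e0 eP]|[e e0 eP]].
  by exists e => // z /normc_eq1 z1 ze; exact: eP.
by apply/nbhs_normcP; exists e => // z ze /normc_eq1 z1; exact: eP.
Qed.

Lemma geometric_tail_le (t : R) k : 0 <= t <= 1 / 2 ->
  \sum_(1 <= i < k) t ^+ i <= 2 * t.
Proof.
move=> /andP[t0 t2]; case: k => [|k]; first by rewrite big_geq// mulr_ge0.
(* Counting the last term twice makes the induction work, since twice the next term is at most the
   last one. *)
suff : \sum_(1 <= i < k.+1) t ^+ i + t ^+ k * (k != 0)%:R <= 2 * t.
  by apply: le_trans; rewrite lerDl mulr_ge0// exprn_ge0.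
elim: k => [|k IH]; first by rewrite big_geq// mulr0 addr0 mulr_ge0.
rewrite big_nat_recr//= mulr1.
case: k IH => [|k]; first by rewrite big_geq//= expr1; lra.
rewrite /= mulr1 => IH.
have : t ^+ k.+2 <= t ^+ k.+1 * (1 / 2).
  by rewrite exprSr ler_wpM2l// exprn_ge0.
lra.
Qed.

Lemma normc_sum I (r : seq I) (F : I -> R[i]) (P : pred I) :
  normc (\sum_(i <- r | P i) F i) <= \sum_(i <- r | P i) normc (F i).
Proof.
elim/big_ind2 : _ => //; first by rewrite normc0.
by move=> x y z w xy zw; rewrite (le_trans (le_normcD _ _))// lerD.
Qed.

(** Convergence is given only at points of the circle, not on a disk. One such point [z0] different
    from [tau] bounds the coefficients, as in Abel's lemma, and a geometric series then gives a
    Lipschitz estimate at [tau]. *)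
Lemma circle_analytic_continuous (h : R[i] -> R[i]) (tau : R[i]) :
  unit_circle tau -> circle_analytic_at h tau ->
  h @ within unit_circle (nbhs tau) --> h tau.
Proof.
move=> /normc_eq1 tau1 [a [r [r0 H]]].
have htau : h tau = a 0%N.
  have := H tau; rewrite subrr normr0 ltcR => /(_ _ r0).
  move=> /(_ (proj1 (normc_eq1 _) tau1)) H0.
  apply: (cvg_unique _ H0); first exact: norm_hausdorff.
  apply/cvg_normcP => e e0; near=> k.
  have k0 : (0 < k)%N by near: k; exists 1%N.
  rewrite /series /= big_ltn// expr0 mulr1 big_nat big1 ?addr0 ?subrr ?normc0//.
  by move=> i /andP[i0 _]; rewrite expr0n gtn_eqF// mulr0.
apply/cvg_normcP => e e0; apply/near_within_circle.
have [[z0 [z01 z0t z0r]]|none] := pselect (exists z0, [/\ normc z0 = 1,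
    z0 != tau & normc (z0 - tau) < r]); last first.
  exists r => // z z1 zr; have -> : z = tau; last by rewrite subrr normc0.
  by apply/eqP/negPn/negP => zt; apply: none; exists z.
set rho := normc (z0 - tau) in z0r.
have rho0 : 0 < rho by rewrite normc_gt0 subr_eq0.
have inT z : normc z = 1 -> normc (z - tau) < r ->
    series (fun k => a k * (z - tau) ^+ k) @ \oo --> h z.
  by move=> z1 zr; apply: H; [exact/normc_eq1|rewrite normCE ltcR].
have [M M0 aM] : exists2 M : R, 0 <= M & forall k, normc (a k) * rho ^+ k <= M.
  have /cvg_normcP/(_ 1 ltr01)[N _ HN] := inT z0 z01 z0r.
  exists (2 + \sum_(k < N) normc (a k) * rho ^+ k).
    by rewrite addr_ge0// sumr_ge0// => i _; rewrite mulr_ge0 ?normc_ge0//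
      exprn_ge0 ?ltW.
  move=> k; have [kN|Nk] := ltnP k N.
    rewrite (bigD1 (Ordinal kN))//= addrCA lerDl addr_ge0// sumr_ge0// => i _.
    by rewrite mulr_ge0 ?normc_ge0// exprn_ge0 ?ltW.
  rewrite -[leLHS]addr0 lerD//; last first.
    by rewrite sumr_ge0// => i _; rewrite mulr_ge0 ?normc_ge0// exprn_ge0 ?ltW.
  (* Past [N], consecutive partial sums are both within 1 of the limit, so each term is at most
     2. *)
  have /= H1 := HN k Nk; have /= H2 := HN k.+1 (leqW Nk).
  rewrite -normcX -normcM -[X in normc X](_ : series (fun k =>
    a k * (z0 - tau) ^+ k) k.+1 - h z0
     - (series (fun k => a k * (z0 - tau) ^+ k) k - h z0) = _).
    rewrite (le_trans (le_normcD _ _))// normcN -[2]/(1 + 1 : R).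
    by rewrite lerD// ltW.
  by rewrite seriesEnat /= big_nat_recr//=; ring.
have key z : normc z = 1 -> normc (z - tau) < r -> normc (z - tau) <= rho / 2 ->
    normc (h z - h tau) <= 2 * M / rho * normc (z - tau).
  move=> z1 zr zr2; set t := normc (z - tau) / rho.
  have t0 : 0 <= t <= 1 / 2.
    apply/andP; split; first by rewrite divr_ge0 ?normc_ge0 ?ltW.
    by rewrite ler_pdivrMr//; lra.
  have S k : normc (series (fun k => a k * (z - tau) ^+ k) k.+1 - a 0%N) <=
    M * (2 * t).
    rewrite seriesEnat /= big_ltn// expr0 mulr1 addrC addKr.
    rewrite (le_trans (normc_sum _ _ _))//.
    apply: (@le_trans _ _ (\sum_(1 <= i < k.+1) M * t ^+ i)).
      apply: ler_sum => i _; rewrite normcM normcX.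
      have -> : normc (z - tau) = rho * t by rewrite mulrC divfK// gt_eqF.
      by rewrite exprMn mulrA ler_wpM2r// exprn_ge0//; case/andP: t0.
    by rewrite -mulr_sumr ler_wpM2l// geometric_tail_le.
  have -> : 2 * M / rho * normc (z - tau) = M * (2 * t) by rewrite /t; ring.
  apply/ler_addgt0Pl => d d0.
  have /cvg_normcP/(_ d d0)[N _ HN] := inT z z1 zr.
  have /= := HN N.+1 (leqnSn N).
  rewrite normcB => /ltW H1; rewrite htau.
  rewrite -[h z - a 0%N](subrKA (series (fun k => a k * (z - tau) ^+ k) N.+1)).
  by rewrite (le_trans (le_normcD _ _))// lerD.
pose d := Num.min r (Num.min (rho / 2) (e / (2 * M / rho + 1))).
have K0 : 0 < 2 * M / rho + 1.
  by rewrite ltr_wpDl// divr_ge0 ?mulr_ge0// ltW.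
exists d; first by rewrite !lt_min r0 !divr_gt0.
move=> z z1; rewrite !lt_min => /and3P[zr zr2 ze].
apply: le_lt_trans (key z z1 zr (ltW zr2)) _.
rewrite ltr_pdivlMr// in ze; apply: le_lt_trans ze.
by rewrite mulrC ler_wpM2l ?normc_ge0// lerDl.
Unshelve. all: by end_near. Qed.

End CircleAnalytic.

(** * Continuous functions on the torus *)

Section TorusFunctions.
Context {R : realType} (f : R[i] * R[i] -> R).
Context (fc : {within torus, continuous f}).

Lemma torus_bounded : exists2 M : R, 0 <= M & forall z, torus z -> `|f z| <= M.
Proof.
have /compact_bounded[M [Mr HM]] := continuous_compact fc compact_torus.
exists (`|M| + 1); first by rewrite addr_ge0.
move=> z Tz; apply: HM; last by exists z.
by rewrite (le_lt_trans (ler_norm M))// ltrDl.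
Qed.

Definition torus_dist2 (z w : R[i] * R[i]) : R :=
  normc (w.1 - z.1) ^+ 2 + normc (w.2 - z.2) ^+ 2.

Lemma torus_dist2_ge0 z w : 0 <= torus_dist2 z w.
Proof. by rewrite addr_ge0// sqr_ge0. Qed.

Lemma torus_dist2_eq0 z w : torus_dist2 z w = 0 -> z = w.
Proof.
move=> /eqP; rewrite paddr_eq0 ?sqr_ge0// !sqrf_eq0 !normc_eq0 !subr_eq0.
by case: z w => [z1 z2] [w1 w2] /= /andP[/eqP-> /eqP->].
Qed.

(** Near the diagonal continuity gives [e]; away from it [torus_dist2] is bounded below and a large
    [C] absorbs the bound [2 * M] on the difference. Treating [C] as a variable tending to infinity
    lets compactness of the product choose one constant for all pairs. *)
Lemma korovkin (e : R) : 0 < e -> exists2 C : R, 0 <= C &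
  forall z w, torus z -> torus w -> `|f w - f z| <= e + C * torus_dist2 z w.
Proof.
move=> e0; have [M M0 fM] := torus_bounded.
pose K := @torus R `*` @torus R.
pose P (C : R) (x : (R[i] * R[i]) * (R[i] * R[i])) := 0 <= C -> K x ->
  `|f x.2 - f x.1| <= e + C * torus_dist2 x.1 x.2.
have /compact_near_coveringP cK : compact K.
  by apply: compact_setX; exact: compact_torus.
have dc : continuous (fun x : (R[i] * R[i]) * (R[i] * R[i]) =>
  torus_dist2 x.1 x.2).
  pose X := ((R[i] * R[i]) * (R[i] * R[i]))%type.
  have nd (u v : X -> R[i]) : continuous u -> continuous v ->
      continuous (fun x => normc (u x - v x) ^+ 2).
    move=> cu cv x.
    have H : {for x, continuous (fun x => normc (u x - v x))}.
      apply: (@continuous_comp _ _ _ (fun x => u x - v x) (@normc R)).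
        by apply: cvgB; [exact: cu|exact: cv].
      exact: continuous_normc.
    rewrite (_ : (fun _ => _) = (fun x => normc (u x - v x) * normc (u x - v
      x))).
      exact: cvgM.
    by apply/funext => y; rewrite expr2.
  have c1 : continuous (@fst (R[i] * R[i]) (R[i] * R[i])) by move=> x;
    exact: cvg_fst.
  have c2 : continuous (@snd (R[i] * R[i]) (R[i] * R[i])) by move=> x;
    exact: cvg_snd.
  have c1' : continuous (@fst R[i] R[i]) by move=> x; exact: cvg_fst.
  have c2' : continuous (@snd R[i] R[i]) by move=> x; exact: cvg_snd.
  move=> x; apply: cvgD; apply: nd.
  - by move=> y; exact: (@continuous_comp _ _ _ snd fst y (c2 y) (c1' _)).
  - by move=> y; exact: (@continuous_comp _ _ _ fst fst y (c1 y) (c1' _)).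
  - by move=> y; exact: (@continuous_comp _ _ _ snd snd y (c2 y) (c2' _)).
  - by move=> y; exact: (@continuous_comp _ _ _ fst snd y (c1 y) (c2' _)).
have fin z : torus z -> \forall w \near z, torus w -> `|f z - f w| < e / 2.
  move=> Tz; have e20 : 0 < e / 2 by rewrite divr_gt0.
  have /subspace_continuousP/(_ z Tz)/cvgrPdist_lt/(_ _ e20) := fc.
  by rewrite near_withinE.
have [C [Cr HC]] : \forall C \near pinfty_nbhs R, K `<=` P C.
  apply: cK.
  move=> [z w] [/= Tz Tw].
  have [d0|d0] := eqVneq (torus_dist2 z w) 0.
    have zw := torus_dist2_eq0 d0; rewrite -{w Tw d0}zw.
    have N := fin z Tz.
    exists ([set x | (torus x.1 -> `|f z - f x.1| < e / 2) /\
                     (torus x.2 -> `|f z - f x.2| < e / 2)], [set C | True]).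
      split; last exact: filterT.
      exists ([set x | torus x -> `|f z - f x| < e / 2],
              [set x | torus x -> `|f z - f x| < e / 2]); first by split;
                exact: N.
      by move=> [x y] [].
    move=> [[x y] C] [/= [Hx Hy] _] C0 [/= Tx Ty].
    have := Hx Tx; have := Hy Ty; rewrite -[f y - f x](subrKA (f z)) => H1 H2.
    rewrite (le_trans (ler_normD _ _))// -[leLHS]addr0 lerD ?mulr_ge0
      ?torus_dist2_ge0//.
    rewrite [leRHS](splitr e) lerD// ?ltW// distrC//.
  have dpos : 0 < torus_dist2 z w by rewrite lt_def d0 torus_dist2_ge0.
  exists ([set x | torus_dist2 z w / 2 < torus_dist2 x.1 x.2],
          [set C | 4 * M / torus_dist2 z w < C]).
    split; last by exists (4 * M / torus_dist2 z w); split => //;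
      exact: num_real.
    have := dc (z, w); move=> /cvgrPdist_lt /(_ (torus_dist2 z w / 2)).
    rewrite divr_gt0// => /(_ isT); apply: filterS => -[x y] /=.
    by rewrite ltr_norml => /andP[_]; lra.
  move=> [[x y] C] [/= Hx HC] C0 [/= Tx Ty].
  have : `|f y - f x| <= 2 * M.
    rewrite (le_trans (ler_normB _ _))//.
    by have := fM _ Tx; have := fM _ Ty; rewrite /=; lra.
  have : 2 * M <= C * torus_dist2 x y.
    apply: (@le_trans _ _ (C * (torus_dist2 z w / 2)));
      last by rewrite ler_wpM2l// ltW.
    by move: HC; rewrite ltr_pdivrMr// => /ltW; lra.
  lra.
exists (`|C| + 1); first by rewrite addr_ge0.
move=> z w Tz Tw; apply: (HC (`|C| + 1) _ (z, w)) => //.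
by rewrite (le_lt_trans (ler_norm C))// ltrDl.
Qed.

End TorusFunctions.

(** * Borel measurability in the plane *)

Section PlaneMeasurability.
Context {R : realType}.

Lemma measurable_open_plane (U : set R[i]) : open U -> measurable U.
Proof. by move=> oU; apply: sub_sigma_algebra. Qed.

Lemma measurable_closed_plane (U : set R[i]) : closed U -> measurable U.
Proof.
move=> cU; rewrite -[U]setCK; apply: measurableC; apply: measurable_open_plane.
exact: closed_openC.
Qed.

Lemma measurable_unit_circle : measurable (@unit_circle R).
Proof. exact: measurable_closed_plane closed_unit_circle. Qed.

Lemma measurable_torus : measurable (@torus R).
Proof. by apply: measurableX; exact: measurable_unit_circle. Qed.

Lemma measurable_finite_plane (A : set R[i]) : finite_set A -> measurable A.
Proof.
move=> fA; apply: measurable_closed_plane.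
apply/accessible_finite_set_closed: A fA.
apply: hausdorff_accessible; exact: norm_hausdorff.
Qed.

Lemma within_continuous_measurable (D : set R[i]) (h : R[i] -> R) :
  measurable D -> {within D, continuous h} -> measurable_fun D h.
Proof.
move=> mD /continuousP ch.
apply: (measurability _ (RGenOpens.measurableE R)).
move=> _ [_ [a [b ->] <-]].
have oab : open (`]a, b[%classic : set R) by exact: interval_open.
have /open_subspaceP[V oV VE] := ch _ oab.
rewrite setIC -VE setIC; apply: measurableI => //; exact: measurable_open_plane.
Qed.

Lemma measurable_fun_off_finite (D E : set R[i]) (h : R[i] -> R) :
  measurable D -> finite_set E ->
  measurable_fun (D `\` E) h -> measurable_fun D h.
Proof.
move=> mD fE mh _ B mB; have mE := measurable_finite_plane fE.
rewrite (_ : _ `&` _ = (D `&` E `&` h @^-1` B) `|` ((D `\` E) `&` h @^-1` B)).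
  apply: measurableU; last by apply: mh => //; exact: measurableD.
  by apply: measurable_finite_plane; apply: sub_finite_set fE => z [[_ ?]].
apply/seteqP; split=> z /=; last by case=> [[[]]|[[]]].
by move=> [Dz Bz]; have [Ez|Ez] := pselect (E z); [left|right].
Qed.

End PlaneMeasurability.

(** * Integration over the circle *)

Section CircleIntegral.
Context {R : realType}.
Implicit Types (h : R[i] -> R) (H G : R[i] -> R[i]) (A B : {poly R[i]}).
Local Notation mu := (@circle_measure R).
Local Notation T := (@unit_circle R).

Lemma normc_cis (t : R) : normc (cis t) = 1.
Proof. by rewrite /cis /= cos2Dsin2 sqrtr1. Qed.

Lemma cis_preimage_circle : cis @^-1` T = [set: R].
Proof. by apply/seteqP; split=> // t _; apply/normc_eq1/normc_cis. Qed.

Lemma circle_measure1 : mu T = 1%E.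
Proof.
rewrite /circle_measure /distribution /pushforward /= cis_preimage_circle.
exact: probability_setT.
Qed.

Lemma within_circle_bounded h : {within T, continuous h} ->
  exists2 M : R, 0 <= M & forall z, normc z = 1 -> `|h z| <= M.
Proof.
move=> hc; have /compact_bounded[M [Mr HM]] := continuous_compact hc
  compact_unit_circle.
exists (`|M| + 1); first by rewrite addr_ge0.
move=> z z1; apply: HM; last by exists z => //; exact/normc_eq1.
by rewrite (le_lt_trans (ler_norm M))// ltrDl.
Qed.

Lemma bounded_circle_integrable h M : measurable_fun T h ->
  (forall z, normc z = 1 -> `|h z| <= M) -> mu.-integrable T (EFin \o h).
Proof.
move=> mh hM; apply: measurable_bounded_integrable => //.
- exact: measurable_unit_circle.
- by rewrite [X in (X < _)%E]circle_measure1 ltry.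
- exists M; split; first exact: num_real.
  move=> x Mx z /normc_eq1 z1; exact: le_trans (hM z z1) (ltW Mx).
Qed.

Lemma circle_integrable h : {within T, continuous h} ->
  mu.-integrable T (EFin \o h).
Proof.
move=> hc; have [M M0 hM] := within_circle_bounded hc.
apply: bounded_circle_integrable hM.
exact: within_continuous_measurable measurable_unit_circle hc.
Qed.

Lemma ge0_circle_integral h : measurable_fun T h ->
  (forall z, normc z = 1 -> 0 <= h z) ->
  (\int[mu]_(z in T) (h z)%:E =
   ((2 * pi)^-1)%:E * \int[@lebesgue_measure R]_(t in `[0%R,
     (2 * pi)%R]) (h (cis t))%:E)%E.
Proof.
move=> mh h0; rewrite /circle_measure /distribution.
rewrite ge0_integral_pushforward//=; first last.
- by move=> z; rewrite inE => /normc_eq1 z1; rewrite lee_fin h0.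
- exact/measurable_EFinP.
- exact: measurable_unit_circle.
rewrite cis_preimage_circle integral_uniform ?subr0//.
- apply/measurable_EFinP.
  have := @measurable_comp _ _ _ _ _ _ T h setT cis.
  apply => //; first exact: measurable_unit_circle.
    by move=> _ [t _ <-]; apply/normc_eq1/normc_cis.
  exact: measurable_cis.
- by move=> t; rewrite lee_fin h0//; exact: normc_cis.
Qed.

Lemma cisX (t : R) k : cis t ^+ k = cis (k%:R * t).
Proof.
elim: k => [|k IH]; first by rewrite mul0r /cis cos0 sin0 expr0.
by rewrite exprS IH -natr1 mulrDl mul1r /cis cosD sinD; simpc; congr (_ +i* _);
  ring.
Qed.

Lemma twopi_gt0 : 0 < 2 * pi :> R.
Proof. by rewrite mulr_gt0// pi_gt0. Qed.

Lemma is_derive_FTC (F f : R -> R) (a b : R) : a < b ->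
  (forall t, is_derive t (1 : R) F (f t)) -> continuous f ->
  (\int[@lebesgue_measure R]_(t in `[a, b]) (f t)%:E = (F b)%:E - (F a)%:E)%E.
Proof.
move=> ab dF cf; apply: continuous_FTC2 => //.
- exact: continuous_subspaceT.
- have cF t : {for t, continuous F}.
    by apply: differentiable_continuous; apply/derivable1_diffP; case: (dF t).
  split; first by move=> t _; case: (dF t).
    by apply: cvg_at_right_filter; exact: cF.
  by apply: cvg_at_left_filter; exact: cF.
- by move=> t _; rewrite derive1E; case: (dF t).
Qed.

Lemma cos_sin_twopi_nat k : cos (k%:R * (2 * pi)) =
  1 :> R /\ sin (k%:R * (2 * pi)) = 0 :> R.
Proof.
have : cis (2 * pi : R) ^+ k = 1.
  rewrite /cis mulr_natl -[pi *+ 2]add0r cosD2pi sinD2pi cos0 sin0.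
  by rewrite -[0 in X in X ^+ _]/(0 : R) -/(1%:C) expr1n.
by rewrite cisX /cis => -[-> ->].
Qed.

(* [1 + h] is nonnegative, so its integral can be computed through the uniform
   law, for which only nonnegative integrands are supported. *)
Lemma circle_integral_eq0 h (F : R -> R) : continuous h ->
  (forall z, normc z = 1 -> `|h z| <= 1) ->
  (forall t, is_derive t (1 : R) F (h (cis t))) -> F (2 * pi) = F 0 ->
  \int[mu]_(z in T) h z = 0.
Proof.
move=> ch h1 dF F0.
have ih : mu.-integrable T (EFin \o h).
  by apply: circle_integrable; exact: continuous_subspaceT.
have i1 : mu.-integrable T (EFin \o (cst 1)).
  by apply: circle_integrable; apply: continuous_subspaceT => z; exact: cvg_cst.
have mT := @measurable_unit_circle R.
have : \int[mu]_(z in T) (1 + h z) = 1.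
  rewrite /Rintegral ge0_circle_integral; last 2 first.
  - apply: within_continuous_measurable => //; apply: continuous_subspaceT => z.
    by apply: cvgD; [exact: cvg_cst|exact: ch].
  - by move=> z /h1; rewrite ler_norml => /andP[];
      rewrite addrC -subr_ge0 opprK.
  rewrite (@is_derive_FTC (fun t => t + F t)) ?twopi_gt0//.
  - by rewrite -EFinB -EFinM /= F0 add0r addrK mulVf// gt_eqF// twopi_gt0.
  - move=> t; apply: cvgD; first exact: cvg_cst.
    by apply: continuous_comp; [exact: continuous_cis|exact: ch].
rewrite RintegralD//= Rintegral_cst// mul1r [X in fine X]circle_measure1 /=.
by move=> H; apply: (addrI (1 : R)); rewrite H addr0.
Qed.

Lemma continuous_exprC k : continuous (fun z : R[i] => z ^+ k).
Proof.
move=> z; rewrite (_ : (fun _ => _) = horner 'X^k);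
  first exact: continuous_hornerC.
by apply/funext => w; rewrite hornerXn.
Qed.

Lemma circle_integral_expr k : (0 < k)%N ->
  \int[mu]_(z in T) complex.Re (z ^+ k) = 0 /\
  \int[mu]_(z in T) complex.Im (z ^+ k) = 0.
Proof.
move=> k0; have kR : k%:R != 0 :> R by rewrite pnatr_eq0 -lt0n.
have z1k (z : R[i]) : normc z = 1 -> normc (z ^+ k) = 1.
  by move=> z1; rewrite normcX z1 expr1n.
have [cos2 sin2] := cos_sin_twopi_nat k.
split.
- apply: (@circle_integral_eq0 _ (fun t => k%:R^-1 * sin (k%:R * t))).
  + by move=> z; apply: (@continuous_comp _ _ _ (fun z : R[i] =>
      z ^+ k) (@complex.Re R));
      [exact: continuous_exprC|exact: continuous_Re].
  + by move=> z /z1k <-; exact: le_Re_normc.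
  + move=> t; rewrite cisX /=; apply: is_derive_eq.
    by rewrite /GRing.scale /=; field.
  + by rewrite sin2 !mulr0 sin0 mulr0.
- apply: (@circle_integral_eq0 _ (fun t => - k%:R^-1 * cos (k%:R * t))).
  + by move=> z; apply: (@continuous_comp _ _ _ (fun z : R[i] =>
      z ^+ k) (@complex.Im R));
      [exact: continuous_exprC|exact: continuous_Im].
  + by move=> z /z1k <-; exact: le_Im_normc.
  + move=> t; rewrite cisX /=; apply: is_derive_eq.
    by rewrite /GRing.scale /=; field.
  + by rewrite cos2 mulr0 cos0.
Qed.

End CircleIntegral.

(** * The mean value property of rational functions *)

Section MeanValue.
Context {R : realType}.
Implicit Types (H G : R[i] -> R[i]) (A B : {poly R[i]}) (z w c : R[i]) (s : seq
  R[i]).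
Local Notation mu := (@circle_measure R).
Local Notation T := (@unit_circle R).
Local Notation cI := (cintegral mu T).

Lemma within_continuousM (D : set R[i]) H G : {within D, continuous H} ->
  {within D, continuous G} -> {within D, continuous (fun z => H z * G z)}.
Proof. by move=> cH cG x; apply: cvgM; [exact: cH|exact: cG]. Qed.

Lemma within_continuousV (D : set R[i]) H : {within D, continuous H} ->
  (forall z, D z -> H z != 0) -> {within D, continuous (fun z => (H z)^-1)}.
Proof.
move=> /subspace_continuousP cH H0; apply/subspace_continuousP => x Dx.
by apply: cvgV; [exact: H0|exact: cH].
Qed.

Lemma within_continuous_horner (D : set R[i]) A : {within D,
  continuous (horner A)}.
Proof. exact/continuous_subspaceT/continuous_hornerC. Qed.

Lemma within_continuous_frac (D : set R[i]) A B : (forall z, D z ->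
  B.[z] != 0) ->
  {within D, continuous (fun z => A.[z] / B.[z])}.
Proof.
move=> B0; apply: within_continuousM; first exact: within_continuous_horner.
by apply: within_continuousV => //; exact: within_continuous_horner.
Qed.

Lemma within_continuous_comp (D : set R[i]) H (g : R[i] -> R) :
  {within D, continuous H} -> continuous g -> {within D, continuous (g \o H)}.
Proof.
move=> cH cg x.
exact: (@continuous_comp (subspace D) _ _ H g x (cH x) (cg _)).
Qed.

Lemma circle_integrableC H : {within T, continuous H} ->
  mu.-integrable T (EFin \o (fun z => complex.Re (H z))) /\
  mu.-integrable T (EFin \o (fun z => complex.Im (H z))).
Proof.
move=> cH; split; apply: circle_integrable.
  exact: within_continuous_comp cH (@continuous_Re R).
exact: within_continuous_comp cH (@continuous_Im R).
Qed.

Lemma cintegralD H G : {within T, continuous H} -> {within T, continuous G} ->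
  cI (fun z => H z + G z) = cI H + cI G.
Proof.
move=> /circle_integrableC[rH iH] /circle_integrableC[rG iG].
have mT := @measurable_unit_circle R.
rewrite /cintegral.
under [\int[mu]_(z in T) complex.Re _]eq_Rintegral do rewrite raddfD.
under [\int[mu]_(z in T) complex.Im _]eq_Rintegral do rewrite raddfD.
by rewrite !RintegralD.
Qed.

Lemma cintegralZ c H : {within T, continuous H} ->
  cI (fun z => c * H z) = c * cI H.
Proof.
move=> /circle_integrableC[rH iH]; have mT := @measurable_unit_circle R.
have iZ (h : R[i] -> R) (k : R) : mu.-integrable T (EFin \o h) ->
    mu.-integrable T (EFin \o (fun z => k * h z)).
  move=> ih; apply: (eq_integrable mT (fun z => k%:E * (EFin \o h) z)%E) => //.
  exact: integrableZl.
case: c => a b; rewrite /cintegral.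
under [\int[mu]_(z in T) complex.Re _]eq_Rintegral => z _.
  rewrite (_ : complex.Re _ = a * complex.Re (H z) - b * complex.Im (H z));
    last by case: (H z).
  over.
under [\int[mu]_(z in T) complex.Im _]eq_Rintegral => z _.
  rewrite (_ : complex.Im _ = a * complex.Im (H z) + b * complex.Re (H z));
    last by case: (H z).
  over.
by rewrite RintegralB ?RintegralD ?RintegralZl//; exact: iZ.
Qed.

(** The 2 comes from bounding real and imaginary parts separately. It is harmless, as the bound only
    meets a factor [c ^+ k] tending to 0. *)
Lemma cintegral_le H M : {within T, continuous H} ->
  (forall z, normc z = 1 -> normc (H z) <= M) -> normc (cI H) <= 2 * M.
Proof.
move=> /circle_integrableC[rH iH] HM; have mT := @measurable_unit_circle R.
have bound (h : R[i] -> R) : mu.-integrable T (EFin \o h) ->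
    (forall z, normc z = 1 -> `|h z| <= M) -> `|\int[mu]_(z in T) h z| <= M.
  move=> ih hM; rewrite (le_trans (le_normr_Rintegral mT ih))//.
  apply: (@le_trans _ _ (\int[mu]_(z in T) M)).
    apply: le_Rintegral => //.
    - exact: integrable_norm.
    - by apply: circle_integrable; apply: continuous_subspaceT => z;
        exact: cvg_cst.
    - by move=> z /normc_eq1 /hM.
  by rewrite Rintegral_cst// [X in fine X]circle_measure1 mulr1.
rewrite (le_trans (normc_le_ReIm _))// mulr_natl mulr2n lerD// bound// => z z1.
  exact: le_trans (le_Re_normc _) (HM _ z1).
exact: le_trans (le_Im_normc _) (HM _ z1).
Qed.

Lemma eq_cintegral H G : (forall z, normc z = 1 -> H z = G z) -> cI H = cI G.
Proof.
move=> HG; congr (_ +i* _); apply: eq_Rintegral => z;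
  by rewrite inE => /normc_eq1 /HG ->.
Qed.

Lemma cintegral_poly A : cI (horner A) = A.[0].
Proof.
(* Splitting off the constant coefficient of a polynomial multiplies the rest by [z]; the power [k]
   absorbs it. *)
suff gen k : cI (fun z => z ^+ k * A.[z]) = (0 ^+ k * A.[0]).
  have := gen 0%N; rewrite expr0 mul1r => <-.
  by apply: eq_cintegral => z _; rewrite expr0 mul1r.
have cX j : {within T, continuous (fun z : R[i] => z ^+ j)}.
  exact/continuous_subspaceT/continuous_exprC.
elim/poly_ind: A k => [|A a IH] k.
  rewrite horner0 mulr0; transitivity (cI (fun z => 0 * z ^+ 0)).
    by apply: eq_cintegral => z _; rewrite horner0 mulr0 mul0r.
  by rewrite cintegralZ// mul0r.
transitivity (cI (fun z => z ^+ k.+1 * A.[z] + a * z ^+ k)).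
  by apply: eq_cintegral => z _; rewrite !hornerE exprSr; ring.
rewrite cintegralD; last 2 first.
- by apply: within_continuousM => //; exact: within_continuous_horner.
- by apply: within_continuousM => //; apply: continuous_subspaceT => z;
    exact: cvg_cst.
rewrite IH cintegralZ// expr0n /= mul0r add0r !hornerE mulrC; congr (_ * _).
case: k => [|k]; last first.
  rewrite expr0n /= /cintegral.
  by have [-> ->] := @circle_integral_expr R k.+1 isT.
rewrite expr0 /cintegral; under eq_Rintegral do rewrite expr0.
under [X in _ +i* X]eq_Rintegral do rewrite expr0.
rewrite !Rintegral_cst; try exact: measurable_unit_circle.
by rewrite [X in fine X]circle_measure1 mul1r mul0r.
Qed.

(** A polynomial without zeros on the closed disk, normalized to be 1 at the origin; [s] lists the
    inverses of its roots, so its elements have modulus less than 1. *)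
Definition inv_roots_poly s : {poly R[i]} := \prod_(c <- s) (1 - c *: 'X).

Lemma inv_roots_polyE s z : (inv_roots_poly s).[z] = \prod_(c <- s) (1 - c * z).
Proof. by rewrite horner_prod; apply: eq_bigr => c _; rewrite !hornerE. Qed.

Lemma inv_roots_poly_neq0 s z : all (fun c => normc c < 1) s -> normc z <= 1 ->
  (inv_roots_poly s).[z] != 0.
Proof.
move=> /allP s1 z1; rewrite inv_roots_polyE prodf_seq_neq0;
  apply/allP => c cs /=.
rewrite subr_eq0; apply/eqP => /(congr1 (@normc R)); rewrite normc1 normcM.
apply/eqP; rewrite gt_eqF//; apply: le_lt_trans (s1 c cs).
by rewrite ler_piMr// normc_ge0.
Qed.

(* With [J B] the integral of [B / inv_roots_poly (c :: s)], expanding the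
   factor [1 / (1 - c z)] gives [J B = B.[0] + c J (z B)]; iterating, the
   remainder is [O(|c|^k)]. *)
Lemma cintegral_inv_roots s A : all (fun c => normc c < 1) s ->
  cI (fun z => A.[z] / (inv_roots_poly s).[z]) = A.[0].
Proof.
elim: s A => [|c s IH] A /= s1.
  rewrite -cintegral_poly; apply: eq_cintegral => z _.
  by rewrite /inv_roots_poly big_nil hornerE divr1.
have /andP[c1 s1'] := s1.
have cs0 z : T z -> (inv_roots_poly (c :: s)).[z] != 0.
  by move=> /normc_eq1 z1; rewrite inv_roots_poly_neq0// z1.
have s0 z : T z -> (inv_roots_poly s).[z] != 0.
  by move=> /normc_eq1 z1; rewrite inv_roots_poly_neq0// z1.
pose J B := cI (fun z => B.[z] / (inv_roots_poly (c :: s)).[z]).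
have JE B : J B = B.[0] + c * J (B * 'X).
  rewrite -(IH B s1') /J -cintegralZ; last exact: within_continuous_frac.
  rewrite -cintegralD; last 2 first.
  - exact: within_continuous_frac.
  - apply: within_continuousM; last exact: within_continuous_frac.
    by apply: continuous_subspaceT => z; exact: cvg_cst.
  apply: eq_cintegral => z z1.
  have := cs0 z (proj1 (normc_eq1 z) z1); rewrite !inv_roots_polyE big_cons.
  rewrite mulf_eq0 => /norP[c0 p0]; rewrite hornerM hornerX.
  by field; rewrite p0 c0.
have JK k : J A = A.[0] + c ^+ k.+1 * J (A * 'X^(k.+1)).
  elim: k => [|k ->]; first by rewrite JE expr1.
  rewrite JE hornerM hornerXn expr0n /= mulr0 add0r mulrA -exprSr.
  by rewrite -mulrA -exprSr.
have [M M0 HM] : exists2 M : R, 0 <= M & forall k, normc (J (A * 'X^k)) <= M.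
  have cF : {within T, continuous (fun z => A.[z] / (inv_roots_poly (c ::
    s)).[z])}.
    exact: within_continuous_frac.
  have [M M0 HM] := within_circle_bounded (within_continuous_comp cF
    (@continuous_normc R)).
  exists (2 * M); first by rewrite mulr_ge0.
  move=> k; apply: cintegral_le; first exact: within_continuous_frac.
  move=> z z1; have := HM z z1; rewrite /= ger0_norm ?normc_ge0//.
  by rewrite hornerM hornerXn mulrAC [normc (_ * z ^+ k)]normcM normcX z1 expr1n
    mulr1.
apply/eqP; rewrite -subr_eq0 -normc_eq0 eq_le normc_ge0 andbT.
apply/ler_addgt0Pl => e e0; rewrite addr0 -/(J A).
have [k ke] : exists k, normc c ^+ k.+1 * M < e.
  have : normc c ^+ k * M @[k --> \oo] --> 0 * M.
    by apply: cvgM; [apply: cvg_expr; rewrite ger0_norm ?normc_ge0|exact: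
      cvg_cst].
  rewrite mul0r => /cvgrPdist_lt/(_ e e0)[N _ HN]; exists N.
  have /= := HN N.+1 (leqnSn N); rewrite sub0r normrN ger0_norm//.
  by rewrite mulr_ge0// exprn_ge0// normc_ge0.
rewrite (JK k) addrC addKr normcM normcX (le_trans _ (ltW ke))//.
by rewrite ler_wpM2l// exprn_ge0// normc_ge0.
Qed.

Lemma cintegral_frac A B : (forall z, normc z <= 1 -> B.[z] != 0) ->
  cI (fun z => A.[z] / B.[z]) = A.[0] / B.[0].
Proof.
move=> B0; have B00 : B.[0] != 0 by rewrite B0// normc0.
have Bn0 : B != 0 by apply: contraNneq B00 => ->; rewrite horner0.
have [s [Bs _ rs]] := factor_roots Bn0.
have s1 a : a \in s -> 1 < normc a.
  by rewrite -rs ltNge => /rootP qb; apply/negP => /B0; rewrite qb eqxx.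
have BE z : B.[z] = B.[0] * (inv_roots_poly [seq a^-1 | a <- s]).[z].
  rewrite Bs !hornerZ !roots_polyE inv_roots_polyE big_map -mulrA;
    congr (_ * _).
  rewrite -big_split /=; apply: eq_big_seq => a /s1 a1.
  have a0 : a != 0 by rewrite -normc_gt0 (lt_trans ltr01).
  by field.
transitivity (cI (fun z => (B.[0])^-1 * (A.[z] / (inv_roots_poly [seq a^-1 | a
  <- s]).[z]))).
  by apply: eq_cintegral => z _; rewrite BE invfM mulrCA.
have s1' : all (fun c => normc c < 1) [seq a^-1 | a <- s].
  apply/allP => _ /mapP[a /s1 a1 ->].
  by rewrite normcV invf_lt1// (lt_trans ltr01).
rewrite cintegralZ; last first.
  by apply: within_continuous_frac => z /normc_eq1 z1;
    rewrite inv_roots_poly_neq0// z1.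
by rewrite cintegral_inv_roots// mulrC.
Qed.

End MeanValue.

(** * The Poisson formula for rational functions *)

Section PoissonFormula.
Context {R : realType}.
Implicit Types (A B : {poly R[i]}) (z w c : R[i]).
Local Notation mu := (@circle_measure R).
Local Notation T := (@unit_circle R).

Lemma ReB z w : complex.Re (z - w) = complex.Re z - complex.Re w.
Proof. exact: raddfB. Qed.

Lemma Re_conjc z : complex.Re (conjc z) = complex.Re z.
Proof. by case: z. Qed.

Lemma ReZ (x : R) z : complex.Re (x%:C * z) = x * complex.Re z.
Proof. by case: z => a b /=; rewrite mul0r subr0. Qed.

Lemma disk_conj_neq0 z w : normc z < 1 -> normc w <= 1 -> 1 - conjc z * w != 0.
Proof.
move=> z1 w1; rewrite subr_eq0; apply/eqP => /(congr1 (@normc R)).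
rewrite normc1 normcM normcJc; apply/eqP; rewrite gt_eqF//.
by apply: le_lt_trans z1; rewrite ler_piMr// normc_ge0.
Qed.

Lemma unitc_sub_neq0 z w : normc z < 1 -> normc w = 1 -> w - z != 0.
Proof.
move=> z1 w1; rewrite subr_eq0; apply: contraTneq z1 => <-.
by rewrite w1 ltxx.
Qed.

Lemma pkerC z w : normc z < 1 -> normc w = 1 ->
  (pker z w)%:C = (1 - (normc z ^+ 2)%:C) * w / ((w - z) * (1 - conjc z * w)).
Proof.
move=> z1 w1; have wz := unitc_sub_neq0 z1 w1; have w0 := unitc_neq0 w1.
have zw : 1 - conjc z * w != 0 by rewrite disk_conj_neq0// w1.
rewrite /pker fmorph_div rmorphB rmorph1 /= [in X in _ / X]sqr_normcJ conjcB.
rewrite (conjc_unit w1) -[RHS]divr1.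
have -> : w^-1 - conjc z = (1 - conjc z * w) / w by field.
by move: (conjc z) (normc z ^+ 2) zw => z' y zw; field; rewrite zw wz w0.
Qed.

Lemma continuous_pker a z : normc a < 1 -> normc z = 1 -> {for z,
  continuous (pker a)}.
Proof.
move=> a1 z1; apply: cvgM; first exact: cvg_cst.
have nc : {for z, continuous (fun w => normc (w - a))}.
  apply: (@continuous_comp _ _ _ (fun w : R[i] => w - a) (@normc R));
    last exact: continuous_normc.
  by apply: cvgB; [exact: cvg_id|exact: cvg_cst].
apply: cvgV; first by rewrite expf_neq0// normc_eq0 unitc_sub_neq0.
rewrite expr2 (_ : (fun _ => _) = (fun w => normc (w - a) * normc (w - a))).
  exact: cvgM.
by apply/funext => v; rewrite expr2.
Qed.

Lemma pker_within z : normc z < 1 -> {within T, continuous (pker z)}.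
Proof.
move=> z1; apply/subspace_continuousP => w /normc_eq1 w1.
by apply: cvg_within_filter; exact: continuous_pker.
Qed.

(** The kernel is the real part of [(w + z) / (w - z)], which has a pole in the disk. On the circle
    the conjugate of this quotient is [(1 + conjc z * w) / (1 - conjc z * w)], with the same real
    part and no pole on the closed disk. *)
Lemma circle_integral_pker z : normc z < 1 -> \int[mu]_(w in T) pker z w = 1.
Proof.
move=> z1; pose A : {poly R[i]} := 1 + (conjc z) *: 'X.
pose B : {poly R[i]} := 1 - (conjc z) *: 'X.
have AE w : A.[w] = 1 + conjc z * w by rewrite !hornerE.
have BE w : B.[w] = 1 - conjc z * w by rewrite !hornerE.
have BD w : normc w <= 1 -> B.[w] != 0 by rewrite BE; exact: disk_conj_neq0.
have := cintegral_frac A BD; rewrite AE BE mulr0 addr0 subr0 divr1.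
move=> /(congr1 (@complex.Re R)) /= <-.
apply: eq_Rintegral => w; rewrite inE => /normc_eq1 w1.
have w0 := unitc_neq0 w1; have zw : 1 - conjc z * w != 0.
  by rewrite disk_conj_neq0// w1.
rewrite pker_Re// -[LHS]Re_conjc AE BE conjcM conjcV conjcB conjcD (conjc_unit
  w1).
by congr complex.Re; move: (conjc z) zw => z' zw; field; rewrite zw w0.
Qed.

(* On the circle, [P_z F - P_z F(z)] is [w] times a rational function without
   poles on the closed disk, so it integrates to 0. *)
Lemma poisson_frac A B z : (forall w, normc w <= 1 -> B.[w] != 0) ->
  normc z < 1 ->
  \int[mu]_(w in T) (pker z w * complex.Re (A.[w] / B.[w])) =
  complex.Re (A.[z] / B.[z]).
Proof.
move=> BD z1; have Bz : B.[z] != 0 by rewrite BD// ltW.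
have /factor_theorem[N NE] : root (B.[z] *: A - A.[z] *: B) z.
  by apply/rootP; rewrite !hornerE mulrC subrr.
have NEw w : B.[z] * A.[w] - A.[z] * B.[w] = N.[w] * (w - z).
  by have := congr1 (horner^~ w) NE; rewrite hornerM hornerXsubC => <-;
    rewrite !hornerE.
pose k := 1 - (normc z ^+ 2)%:C.
pose C : {poly R[i]} := B.[z] *: B * (1 - (conjc z) *: 'X).
have CE w : C.[w] = B.[z] * B.[w] * (1 - conjc z * w) by rewrite !hornerE.
have CD w : normc w <= 1 -> C.[w] != 0.
  by move=> w1; rewrite CE !mulf_neq0// ?BD// disk_conj_neq0.
pose W w := (k *: ('X * N)).[w] / C.[w].
have cW : {within T, continuous W}.
  by apply: within_continuous_frac => w /normc_eq1 w1; rewrite CD// w1.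
have W0 : \int[mu]_(w in T) complex.Re (W w) = 0.
  have := cintegral_frac (k *: ('X * N)) CD.
  rewrite hornerZ hornerM hornerX mul0r mulr0 mul0r =>
    /(congr1 (@complex.Re R)) //.
have split w : normc w = 1 -> pker z w * complex.Re (A.[w] / B.[w]) =
    complex.Re (A.[z] / B.[z]) * pker z w + complex.Re (W w).
  move=> w1; rewrite [complex.Re _ * pker _ _]mulrC -!ReZ -raddfD;
    congr complex.Re.
  rewrite pkerC// /W CE hornerZ hornerM hornerX -/k.
  have Bw : B.[w] != 0 by rewrite BD// w1.
  have zw : 1 - conjc z * w != 0 by rewrite disk_conj_neq0// w1.
  have wz := unitc_sub_neq0 z1 w1.
  have -> : A.[w] = (N.[w] * (w - z) + A.[z] * B.[w]) / B.[z].
    by rewrite -NEw subrK mulrC mulKf.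
  by move: (k) (conjc z) zw => k' z' zw; field; rewrite zw wz Bw Bz.
have mT := @measurable_unit_circle R.
have iW : mu.-integrable T (EFin \o (fun w => complex.Re (W w))).
  by have [] := circle_integrableC cW.
have iP : mu.-integrable T (EFin \o pker z) by
  exact/circle_integrable/pker_within.
transitivity (\int[mu]_(w in T)
    (complex.Re (A.[z] / B.[z]) * pker z w + complex.Re (W w))).
  by apply: eq_Rintegral => w; rewrite inE => /normc_eq1 /split.
rewrite RintegralD//; last first.
  apply: (eq_integrable mT (fun w => (complex.Re (A.[z] / B.[z]))%:E * (EFin \o
    pker z) w)%E) => //.
  exact: integrableZl.
by rewrite RintegralZl// circle_integral_pker// W0 mulr1 addr0.
Qed.

(* The Poisson kernel at [r z] has integral 1 and takes the value
   [(1 + r) / (1 - r)] at [z]. *)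
Lemma circle_measure_set1 z : normc z = 1 -> mu [set z] = 0%E.
Proof.
move=> z1; have mT := @measurable_unit_circle R.
have m1 : measurable [set z] by exact: measurable_finite_plane.
have zT : [set z] `<=` T by move=> _ ->; apply/normc_eq1.
apply/eqP; rewrite eq_le measure_ge0 andbT.
have fin1 : mu [set z] \is a fin_num by exact: fin_num_measure.
rewrite -(fineK fin1) lee_fin; apply/ler_addgt0Pl => e e0; rewrite addr0.
(* Chosen so that [1 - r = r * e], whence [(1 - r) / (1 + r) <= e]. *)
pose r : R := (1 + e)^-1.
have r0 : 0 < r by rewrite invr_gt0 addr_gt0.
have r1 : r < 1 by rewrite invf_lt1 ?addr_gt0// ltrDl.
have rz1 : normc (r%:C * z) < 1 by rewrite normcM z1 mulr1 normcRC gtr0_norm.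
have pz : pker (r%:C * z) z = (1 + r) / (1 - r).
  rewrite /pker normcM z1 mulr1 normcRC gtr0_norm//.
  have -> : z - r%:C * z = (1 - r)%:C * z by rewrite rmorphB rmorph1 mulrBl
    mul1r.
  rewrite normcM z1 mulr1 normcRC ger0_norm ?subr_ge0 1?ltW//.
  by field; rewrite subr_eq0 gt_eqF.
have iP := circle_integrable (pker_within rz1).
have i1 : mu.-integrable T (EFin \o \1_[set z]).
  apply: (@bounded_circle_integrable _ _ 1); first exact: measurable_indic.
  by move=> w _; rewrite indicE; case: (_ \in _); rewrite ?normr1 ?normr0.
have : \int[mu]_(w in T) ((1 + r) / (1 - r) * \1_[set z] w) <= 1.
  rewrite -[leRHS](circle_integral_pker rz1); apply: le_Rintegral => //.
    apply: (eq_integrable mT (fun w => ((1 + r) / (1 - r))%:E * (EFin \o \1_[set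
      z]) w)%E) => //.
    exact: integrableZl.
  move=> w Tw; rewrite indicE; have [->|wz] := eqVneq w z.
    by rewrite mem_set// mulr1 pz.
  rewrite memNset ?mulr0 ?pker_ge0//; exact/eqP.
rewrite RintegralZl// /Rintegral integral_indic// setIidl// => H.
have : fine (mu [set z]) <= (1 - r) / (1 + r).
  rewrite ler_pdivlMr ?addr_gt0// mulrC; move: H.
  by rewrite mulrAC ler_pdivrMr ?subr_gt0// mul1r.
move=> /le_trans; apply.
rewrite ler_pdivrMr ?addr_gt0//.
have -> : 1 - r = r * e by rewrite /r; field; rewrite gt_eqF// addr_gt0.
by rewrite mulrC mulrDr ler_wpDl// ?mulr_ge0// ltW.
Qed.

Lemma circle_measure_finite0 (E : set R[i]) : finite_set E -> mu E = 0%E.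
Proof.
move=> /finite_seqP[s ->]; elim: s => [|z s IH].
  by rewrite set_nil measure0.
have m1 w : measurable [set w : R[i]] by exact: measurable_finite_plane.
have ms : measurable [set` s] by exact: measurable_finite_plane.
have z0 : mu [set z] = 0%E.
  have [z1|z1] := pselect (normc z = 1); first exact: circle_measure_set1.
  rewrite /circle_measure /distribution /pushforward /= (_ : _ @^-1` _ =
    set0) ?measure0//.
  by rewrite -subset0 => t /= tz; apply: z1; rewrite -tz normc_cis.
have -> : [set` z :: s] = [set z] `|` [set` s].
  apply/seteqP; split=> w /=; rewrite inE; first by case/orP=> [/eqP|];
    [left|right].
  by case=> [->|->]; rewrite ?eqxx ?orbT.
apply/eqP; rewrite eq_le measure_ge0 andbT.
rewrite (le_trans (measureU2 mu (m1 z) ms))//.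
by rewrite [X in (X + _)%E]z0 [X in (_ + X)%E]IH adde0.
Qed.

End PoissonFormula.

(** * Density of the Poisson kernels *)

Section DiscretePoissonKernel.
Context {R : realType}.
Implicit Types (a z w : R[i]) (r : R).

(** For [w] on the circle, [|w - a|^2 = (1 - r)^2 + r |a / r - w|^2]. Dropping the first square, the
    squared distance cancels the denominator of the kernel. *)
Lemma pker_dist2_le r a w : 0 < r -> r < 1 -> normc a = r -> normc w = 1 ->
  pker a w * normc (a / r%:C - w) ^+ 2 <= (1 - r ^+ 2) / r.
Proof.
move=> r0 r1 ar w1.
have rC : r%:C != 0 by rewrite -normc_eq0 normcRC normr_eq0 gt_eqF.
have E : normc (w - a) ^+ 2 = (1 - r) ^+ 2 + r * normc (a / r%:C - w) ^+ 2.
  have aa : a * conjc a = (r ^+ 2)%:C by rewrite -sqr_normcJ ar.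
  have ww : w * conjc w = 1 by rewrite -sqr_normcJ w1 expr1n.
  have EC (y : R) : ((1 - r) ^+ 2 + r * y)%:C = (1 - r%:C) ^+ 2 + r%:C * y%:C.
    by rewrite !expr2 rmorphD !rmorphM rmorphB rmorph1.
  apply: complexI; rewrite EC !sqr_normcJ.
  rewrite !conjcB conjcM conjcV conjc_real.
  have -> : (w - a) * (conjc w - conjc a) = 1 + (r ^+ 2)%:C - w * conjc a - a *
    conjc w.
    by rewrite -ww -aa; ring.
  have -> : (a / r%:C - w) * (conjc a / r%:C - conjc w) =
     1 + (r ^+ 2)%:C / r%:C ^+ 2 - (w * conjc a + a * conjc w) / r%:C.
    by rewrite -ww -aa; field.
  rewrite rmorphXn /= divff ?expf_neq0//.
  by move: (w * _) (a * _) => x y; field.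
have wa0 : 0 < normc (w - a) ^+ 2.
  by rewrite exprn_gt0// normc_gt0 unitc_sub_neq0// ar.
rewrite /pker ar ler_pdivlMr// mulrAC -[leLHS]mulrA -[leRHS]mulr1.
rewrite mulrAC ler_pdivrMr// -mulrA.
rewrite ler_wpM2l//; first by rewrite subr_ge0 expr_le1 ?ltW.
by rewrite mul1r [leRHS]E mulrC lerDr sqr_ge0.
Qed.

Lemma pker_dist1_le r w : 0 <= r -> r <= 1 / 2 -> normc w = 1 ->
  `|pker r%:C w - 1| <= 4 * r.
Proof.
move=> r0 r2 w1.
have nr : normc r%:C = r by rewrite normcRC ger0_norm.
have [h1 h2] : 1 - r <= normc (w - r%:C) /\ normc (w - r%:C) <= 1 + r.
  split; first by rewrite -[X in X - _]w1 -{1}nr le_normc_sub.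
  by rewrite (le_trans (le_normcD _ _))// normcN w1 nr.
rewrite /pker nr; set d := normc _ in h1 h2 *.
have d0 : 0 < d by lra.
have d20 : 0 < d ^+ 2 by rewrite exprn_gt0.
have dl : (1 - r) ^+ 2 <= d ^+ 2 by rewrite ler_sqr// nnegrE; lra.
have du : d ^+ 2 <= (1 + r) ^+ 2 by rewrite ler_sqr// nnegrE; lra.
move: (d ^+ 2) d20 dl du => D D0 dl du.
rewrite ler_norml; apply/andP; split.
  rewrite lerBrDl ler_pdivlMr//; have [r4|r4] := lerP (1 - 4 * r) 0.
    have H1 : (1 - 4 * r) * D <= 0 by rewrite mulr_le0_ge0// ltW.
    have H2 : 0 <= (1 - r) * (1 + r) by rewrite mulr_ge0//; lra.
    lra.
  have H1 := ler_wpM2l (ltW r4) du.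
  (* Twice this product is [1 - r ^+ 2 - (1 - 4 * r) * (1 + r) ^+ 2]. *)
  have H2 : 0 <= r * (1 + r) * (1 + 2 * r) by rewrite !mulr_ge0//; lra.
  lra.
rewrite lerBlDl ler_pdivrMr//.
have r4 : 0 <= 1 + 4 * r by lra.
have H1 := ler_wpM2l r4 dl.
(* Twice this product is [(1 + 4 * r) * (1 - r) ^+ 2 - (1 - r ^+ 2)]; its sign is where [r <= 1 / 2]
   enters. *)
have H2 : 0 <= r * (1 - r) * (1 - 2 * r) by rewrite !mulr_ge0//; lra.
lra.
Qed.

(* The points are the roots of ['X^k.+1 - r^k.+1]; the sum of the kernels is
   read off the logarithmic derivative of this polynomial. *)
Lemma kernel_points r k : 0 < r -> exists s : seq R[i],
  [/\ size s = k.+1, all (fun a => normc a == r) s & forall w, normc w = 1 ->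
    r < 1 ->
     \sum_(a <- s) pker a w = k.+1%:R * pker ((r ^+ k.+1)%:C) (w ^+ k.+1)].
Proof.
move=> r0; pose h : {poly R[i]} := 'X^(k.+1) - ((r ^+ k.+1)%:C)%:P.
have mh : h \is monic by exact: monicXnsubC.
have h0 : h != 0 by rewrite monic_neq0.
have [s [hs ss rs]] := factor_roots h0.
rewrite (monicP mh) scale1r in hs.
have sk : size s = k.+1 by move: ss; rewrite size_XnsubC// => -[].
have as_ : all (fun a => normc a == r) s.
  apply/allP => a; rewrite -rs => /rootP; rewrite !hornerE => /eqP.
  rewrite subr_eq0 => /eqP /(congr1 (@normc R)); rewrite normcX normcRC.
  rewrite ger0_norm ?exprn_ge0 ?ltW// => /eqP.
  by rewrite eqrXn2// ?normc_ge0 ?ltW.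
exists s; split=> // w w1 r1.
have hw : (roots_poly s).[w] != 0.
  rewrite -hs; apply/negP => /rootP/rootP; rewrite rs => /(allP as_)/eqP.
  by rewrite w1 => r11; rewrite r11 ltxx in r1.
rewrite -(roots_poly_logderiv w1 hw) -hs sk.
have wk1 : normc (w ^+ k.+1) = 1 by rewrite normcX w1 expr1n.
rewrite pker_Re// /h derivB derivC subr0 derivXn hornerMn !hornerE /=.
set rho := (r ^+ k.+1)%:C; have d0 : w ^+ k.+1 - rho != 0.
  by move: hw; rewrite -hs !hornerE.
have -> : w * (w ^+ k *+ k.+1) / (w ^+ k.+1 - rho) =
   (k.+1%:R : R)%:C * (w ^+ k.+1 / (w ^+ k.+1 - rho)).
  by rewrite mulrnAr -exprS -mulr_natl rmorph_nat mulrA.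
have -> : (w ^+ k.+1 + rho) / (w ^+ k.+1 - rho) =
    (2 : R)%:C * (w ^+ k.+1 / (w ^+ k.+1 - rho)) - 1.
  by rewrite rmorph_nat; field.
by move: (w ^+ k.+1 / _) => X; rewrite ReB !ReZ /=; ring.
Qed.

(** Here [u] stands for a value of [f], [x] and [y] for the total masses of the kernels in the two
    variables, [q1] and [q2] for their second moments, [B] for the weighted differences of [f].
    Masses are at most 2, so the three contributions are at most [3 * M * d], [e / 12 * 4] and
    [16 * C * t], a third of [e] each. *)
Lemma product_kernel_error (e C M d t u x y q1 q2 B : R) :
  0 <= C -> 0 <= t -> d <= 1 -> `|u| <= M -> `|x - 1| <= d -> `|y - 1| <= d ->
  0 <= q1 -> q1 <= 4 * t -> 0 <= q2 -> q2 <= 4 * t ->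
  `|B| <= e / 12 * (x * y) + C * (q1 * y + x * q2) ->
  16 * C * t <= e / 3 -> 3 * M * d <= e / 3 ->
  `|u| * `|1 - x * y| + `|B| <= e.
Proof.
move=> C0 t0 d1 uM xd yd q10 q1t q20 q2t bB tC dM.
have d0 : 0 <= d by exact: le_trans xd.
have e0 : 0 <= e by have := mulr_ge0 C0 t0; lra.
have uv : `|(x - 1) * (y - 1)| <= d.
  rewrite normrM -[leRHS]mulr1; apply: ler_pM => //; exact: le_trans yd d1.
move: xd yd uv; rewrite !ler_norml => /andP[x1 x2] /andP[y1 y2] /andP[uv1 uv2].
have x0 : 0 <= x by lra.
have y0 : 0 <= y by lra.
have h1 : `|u| * `|1 - x * y| <= M * (3 * d).
  apply: ler_pM => //; rewrite ler_norml; apply/andP; split; lra.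
have xy4 : x * y <= 4 by lra.
have h2 : e / 12 * (x * y) <= e / 12 * 4 by rewrite ler_wpM2l// divr_ge0.
have h3 : q1 * y <= 4 * t * 2 by apply: ler_pM => //; lra.
have h4 : x * q2 <= 2 * (4 * t) by apply: ler_pM => //; lra.
have h5 : C * (q1 * y + x * q2) <= C * (4 * t * 2 + 2 * (4 * t)).
  by rewrite ler_wpM2l// lerD.
lra.
Qed.

(* Korovkin's argument, for the discrete Poisson kernels of [kernel_points]. *)
Lemma poisson_approximation (f : R[i] * R[i] -> R) (e : R) :
  {within torus, continuous f} -> 0 < e ->
  exists (s : seq R[i]) (c : R[i] -> R[i] -> R), all (fun a => normc a < 1) s /\
    forall z : R[i] * R[i], torus z ->
      `|f z - \sum_(a <- s) \sum_(b <- s) c a b * (pker a z.1 * pker b z.2)| <=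
        e.
Proof.
move=> fc e0.
have [M M0 fM] := torus_bounded fc.
have e12 : 0 < e / 12 by rewrite divr_gt0.
have [C C0 fC] := korovkin fc e12.
(* The distance of the nodes from the circle, [t = 1 - r], is fixed first, through the Korovkin
   constant: it alone controls the second moments, by [(2 - t) / (1 - t) <= 4]. The number of nodes
   is chosen afterwards and controls the total mass. *)
pose t := Num.min (1 / 2) (e / (48 * (C + 1))).
have C10 : 0 < 48 * (C + 1) by rewrite mulr_gt0// ltr_wpDl.
have t0 : 0 < t by rewrite lt_min !divr_gt0.
have t2 : t <= 1 / 2 by rewrite ge_min lexx.
have tC : 16 * C * t <= e / 3.
  have : t <= e / (48 * (C + 1)) by rewrite ge_min lexx orbT.
  rewrite ler_pdivlMr// => H; have := mulr_ge0 C0 (ltW t0); lra.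
pose r := 1 - t.
have r0 : 0 < r by rewrite /r; lra.
have r1 : r < 1 by rewrite /r; lra.
have rt : (1 - r ^+ 2) / r <= 4 * t.
  by rewrite ler_pdivrMr// /r; nra.
pose d := Num.min 1 (e / (9 * (M + 1))).
have M10 : 0 < 9 * (M + 1) by rewrite mulr_gt0// ltr_wpDl.
have d0 : 0 < d by rewrite lt_min ltr01 divr_gt0.
have d1 : d <= 1 by rewrite ge_min lexx.
have dM : 3 * M * d <= e / 3.
  have : d <= e / (9 * (M + 1)) by rewrite ge_min lexx orbT.
  rewrite ler_pdivlMr// => H; have := mulr_ge0 M0 (ltW d0); lra.
(* The mass at [w] will be the kernel of [r ^+ k.+1] at [w ^+ k.+1], which [pker_dist1_le] puts
   within [4 * r ^+ k.+1] of 1. *)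
have [k kd] : exists k, r ^+ k.+1 <= d / 4.
  have : r ^+ k @[k --> \oo] --> 0 by apply: cvg_expr; rewrite gtr0_norm.
  have d40 : 0 < d / 4 by rewrite divr_gt0.
  move=> /cvgrPdist_lt/(_ _ d40)[N _ HN]; exists N.
  have /= := HN N.+1 (leqnSn N); rewrite sub0r normrN ger0_norm;
    first by move=> /ltW.
  by rewrite exprn_ge0// ltW.
have [s [sk as_ sums]] := kernel_points k r0.
pose N : R := k.+1%:R; have N0 : 0 < N by rewrite ltr0n.
pose K a w := pker a w / N.
have aD a : a \in s -> normc a < 1 by move=> /(allP as_)/eqP ->.
have K0 a w : a \in s -> 0 <= K a w.
  by move=> /aD a1; rewrite divr_ge0 ?pker_ge0// ltW.
have S1 w : normc w = 1 -> `|\sum_(a <- s) K a w - 1| <= d.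
  move=> w1; rewrite -mulr_suml sums// -/N mulrAC divff ?gt_eqF// mul1r.
  have wk1 : normc (w ^+ k.+1) = 1 by rewrite normcX w1 expr1n.
  have rk0 : 0 <= r ^+ k.+1 by rewrite exprn_ge0// ltW.
  have rk2 : r ^+ k.+1 <= 1 / 2 by lra.
  by apply: le_trans (pker_dist1_le rk0 rk2 wk1) _; lra.
have Q w : normc w = 1 ->
    \sum_(a <- s) K a w * normc (a / r%:C - w) ^+ 2 <= 4 * t.
  move=> w1; apply: le_trans rt.
  apply: (@le_trans _ _ (\sum_(a <- s) ((1 - r ^+ 2) / r) / N)).
    rewrite !big_seq; apply: ler_sum => a /(allP as_)/eqP ar.
    by rewrite /K mulrAC; apply: ler_wpM2r; rewrite ?pker_dist2_le// invr_ge0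
      ltW.
  by rewrite big_const_seq count_predT iter_addr_0 sk -mulr_natr divfK// gt_eqF.
exists s, (fun a b => f (a / r%:C, b / r%:C) / N ^+ 2); split.
  by apply/allP => a /aD.
move=> z Tz; have [/normc_eq1 z1 /normc_eq1 z2] := Tz.
set S := fun w => \sum_(a <- s) K a w.
have dbl (g1 g2 : R[i] -> R) : \sum_(a <- s) \sum_(b <- s) g1 a * g2 b =
    (\sum_(a <- s) g1 a) * \sum_(b <- s) g2 b.
  by rewrite mulr_suml; apply: eq_bigr => a _; rewrite mulr_sumr.
have -> : f z - \sum_(a <- s) \sum_(b <- s) f (a / r%:C, b / r%:C) / N ^+ 2 *
      (pker a z.1 * pker b z.2) =
    f z * (1 - S z.1 * S z.2) + \sum_(a <- s) \sum_(b <- s)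
      K a z.1 * K b z.2 * (f z - f (a / r%:C, b / r%:C)).
  rewrite mulrBr mulr1 -addrA; congr (_ + _).
  rewrite -dbl mulr_sumr -!sumrN -big_split; apply: eq_bigr => a _ /=.
  rewrite mulr_sumr -!sumrN -big_split; apply: eq_bigr => b _ /=.
  by rewrite /K; field; rewrite gt_eqF.
have Tab a b : a \in s -> b \in s -> torus (a / r%:C, b / r%:C).
  move=> /(allP as_)/eqP ar /(allP as_)/eqP br.
  by split; apply/normc_eq1; rewrite normcM normcV normcRC gtr0_norm// ?ar ?br
    divff// gt_eqF.
have S1z : `|S z.1 - 1| <= d by exact: S1.
have S2z : `|S z.2 - 1| <= d by exact: S1.
have Q1z := Q _ z1; have Q2z := Q _ z2.
have bsum : `|\sum_(a <- s) \sum_(b <- s)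
      K a z.1 * K b z.2 * (f z - f (a / r%:C, b / r%:C))| <=
    \sum_(a <- s) \sum_(b <- s) K a z.1 * K b z.2 *
      (e / 12 + C * (normc (a / r%:C - z.1) ^+ 2 + normc (b / r%:C - z.2) ^+
        2)).
  rewrite (le_trans (ler_norm_sum _ _ _))// !big_seq; apply: ler_sum => a as1.
  rewrite (le_trans (ler_norm_sum _ _ _))// !big_seq; apply: ler_sum => b bs1.
  have KK := mulr_ge0 (K0 a z.1 as1) (K0 b z.2 bs1).
  rewrite normrM (ger0_norm KK); apply: ler_wpM2l => //; rewrite distrC.
  exact: fC (Tab _ _ as1 bs1).
have bsumE : \sum_(a <- s) \sum_(b <- s) K a z.1 * K b z.2 *
      (e / 12 + C * (normc (a / r%:C - z.1) ^+ 2 + normc (b / r%:C - z.2) ^+ 2))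
        =
   e / 12 * (S z.1 * S z.2) +
   C * ((\sum_(a <- s) K a z.1 * normc (a / r%:C - z.1) ^+ 2) * S z.2 +
        S z.1 * (\sum_(b <- s) K b z.2 * normc (b / r%:C - z.2) ^+ 2)).
  rewrite -!dbl -big_split !mulr_sumr -big_split; apply: eq_bigr => a _ /=.
  rewrite -big_split !mulr_sumr -big_split; apply: eq_bigr => b _ /=; ring.
rewrite (le_trans (ler_normD _ _))// normrM.
rewrite bsumE in bsum.
have Q10 : 0 <= \sum_(a <- s) K a z.1 * normc (a / r%:C - z.1) ^+ 2.
  by rewrite big_seq sumr_ge0// => a as1; rewrite mulr_ge0 ?K0 ?sqr_ge0.
have Q20 : 0 <= \sum_(a <- s) K a z.2 * normc (a / r%:C - z.2) ^+ 2.
  by rewrite big_seq sumr_ge0// => a as1; rewrite mulr_ge0 ?K0 ?sqr_ge0.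
exact: (product_kernel_error C0 (ltW t0) d1 (fM z Tz) S1z S2z) Q10 Q1z Q20 Q2z
  bsum tC dM.
Qed.

End DiscretePoissonKernel.

(** * Radial limits and derivatives of quotients *)

Section RadialLimits.
Context {R : realType}.
Implicit Types (z w v : R[i]) (q : {poly R[i]}).

Lemma radial_le (u v : R[i] -> R) z : {for z, continuous u} -> {for z,
  continuous v} ->
  normc z = 1 -> (forall w, normc w < 1 -> u w <= v w) -> u z <= v z.
Proof.
move=> cu cv z1 uv; rewrite leNgt; apply/negP => vu.
have d0 : 0 < (u z - v z) / 2 by rewrite divr_gt0// subr_gt0.
have /cvgrPdist_lt/(_ _ d0)/nbhs_normcP[e1 e10 H1] := cu.
have /cvgrPdist_lt/(_ _ d0)/nbhs_normcP[e2 e20 H2] := cv.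
pose t : R := Num.min (1 / 2) (Num.min (e1 / 2) (e2 / 2)).
have t0 : 0 < t by rewrite !lt_min !divr_gt0.
have t1 : t <= 1 / 2 by rewrite ge_min lexx.
have te1 : t < e1 by rewrite (@le_lt_trans _ _ (e1 / 2))// ?ge_min ?lexx
  ?orbT//; lra.
have te2 : t < e2 by rewrite (@le_lt_trans _ _ (e2 / 2))// ?ge_min ?lexx
  ?orbT//; lra.
pose w := (1 - t)%:C * z.
have w1 : normc w < 1 by rewrite normcM z1 mulr1 normcRC ger0_norm; lra.
have wz : normc (w - z) = t.
  have -> : w - z = (- t)%:C * z by rewrite /w rmorphB rmorph1 rmorphN; ring.
  by rewrite normcM z1 mulr1 normcRC normrN gtr0_norm.
have := H1 w; have := H2 w; rewrite wz => /(_ te2) h2 /(_ te1) h1.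
have := uv w w1; move: h1 h2; rewrite /= !ltr_norml => /andP[a b] /andP[c d];
  lra.
Qed.

(* A quantitative form of Hurwitz's theorem: the constant does not depend on
   [q], so the bound passes to radial limits. *)
Lemma zero_free_disk_lower_bound n q w v : q != 0 -> (size q <= n.+1)%N ->
  (forall w, normc w < 1 -> q.[w] != 0) -> normc w < 1 -> normc v <= 1 ->
  ((1 - normc w) / 2) ^+ n * normc q.[v] <= normc q.[w].
Proof.
move=> q0 sq qD w1 v1; have [s [qs ss rs]] := factor_roots q0.
have s1 a : a \in s -> 1 <= normc a.
  rewrite -rs leNgt => /rootP qa; apply/negP => /qD; by rewrite qa eqxx.
have w0 := normc_ge0 w.
set c := (1 - normc w) / 2.
have c0 : 0 <= c by rewrite /c; lra.
have c1 : c <= 1 by rewrite /c; lra.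
have sn : (size s <= n)%N by rewrite -ltnS ss.
apply: (@le_trans _ _ (c ^+ size s * normc q.[v])).
  by rewrite ler_wpM2r ?normc_ge0// ler_wiXn2l.
rewrite qs !hornerZ !normcM mulrCA ler_wpM2l ?normc_ge0// !roots_polyE.
elim: s s1 {qs ss rs sn} => [|a s IH] s1.
  by rewrite !big_nil expr0 mul1r.
rewrite !big_cons exprS !normcM mulrACA; apply: ler_pM.
- by rewrite mulr_ge0// normc_ge0.
- by rewrite mulr_ge0 ?normc_ge0// exprn_ge0.
- have a1 := s1 a (mem_head _ _).
  have h1 : normc a - normc w <= normc (w - a) by rewrite normcB le_normc_sub.
  have h2 : normc (v - a) <= normc v + normc a.
    by rewrite (le_trans (le_normcD _ _))// normcN.
  have h3 : c * normc (v - a) <= c * (1 + normc a) by rewrite ler_wpM2l//; lra.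
  have h4 : 0 <= (normc a - 1) * (1 + normc w) by rewrite mulr_ge0//; lra.
  move: h3; rewrite /c; lra.
- by apply: IH => b bs; apply: s1; rewrite inE bs orbT.
Qed.

(** By the factor theorem the difference quotient is exactly [N.[x] / (b.[w] * b.[x])] near [w], so
    the derivative is the value at [w] of a continuous function. *)
Lemma derive1_frac (a b : {poly R[i]}) w : b.[w] != 0 ->
  derive1 (fun x => a.[x] / b.[x]) w =
  (a^`().[w] * b.[w] - a.[w] * b^`().[w]) / b.[w] ^+ 2.
Proof.
move=> bw.
have /factor_theorem[N NE] : root (b.[w] *: a - a.[w] *: b) w.
  by apply/rootP; rewrite !hornerE mulrC subrr.
have NEx x : b.[w] * a.[x] - a.[w] * b.[x] = N.[x] * (x - w).
  by have := congr1 (horner^~ x) NE; rewrite hornerM hornerXsubC => <-;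
    rewrite !hornerE.
have Nw : N.[w] = a^`().[w] * b.[w] - a.[w] * b^`().[w].
  have := congr1 (fun p : {poly R[i]} => p^`().[w]) NE.
  rewrite derivM derivXsubC mulr1 derivB !derivZ !hornerE subrr mulr0 add0r =>
    <-.
  by rewrite mulrC.
apply: cvg_lim; first exact: norm_hausdorff.
have cq : {for 0, continuous (fun h : R[i] => N.[h + w] / (b.[w] * b.[h + w]))}.
  have cs p : {for 0, continuous (fun h : R[i] => p.[h + w])}.
    apply: (@continuous_comp _ _ _ (fun h : R[i] => h + w) (horner p));
      last exact: continuous_hornerC.
    by apply: cvgD; [exact: cvg_id|exact: cvg_cst].
  apply: cvgM; first exact: cs.
  apply: cvgV; first by rewrite add0r mulf_neq0.
  by apply: cvgM; [exact: cvg_cst|exact: cs].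
have -> : (a^`().[w] * b.[w] - a.[w] * b^`().[w]) / b.[w] ^+ 2 =
    N.[0 + w] / (b.[w] * b.[0 + w]) by rewrite add0r Nw expr2.
apply: (@cvg_trans _ ((fun h : R[i] => N.[h + w] / (b.[w] * b.[h + w])) @ 0^'));
  last first.
  by apply: cvg_within_filter; exact: cq.
apply: near_eq_cvg.
have cb : {for 0, continuous (fun h : R[i] => normc b.[h + w])}.
  apply: (@continuous_comp _ _ _ (fun h : R[i] => b.[h + w]) (@normc R));
    last exact: continuous_normc.
  apply: (@continuous_comp _ _ _ (fun h : R[i] => h + w) (horner b));
    last exact: continuous_hornerC.
  by apply: cvgD; [exact: cvg_id|exact: cvg_cst].
have bn0 : 0 < normc b.[0 + w] by rewrite add0r normc_gt0.
have /cvgrPdist_lt/(_ _ bn0) Hb := cb.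
rewrite near_withinE; near=> h => h0.
have bh : b.[h + w] != 0.
  have : `|normc b.[0 + w] - normc b.[h + w]| < normc b.[0 + w] by near: h;
    exact: Hb.
  by apply: contraTneq => ->; rewrite normc0 subr0 ger0_norm ?ltxx// ltW.
rewrite /GRing.scale /=.
have -> : a.[h + w] = (N.[h + w] * h + a.[w] * b.[h + w]) / b.[w].
  by have := NEx (h + w); rewrite addrK => <-; rewrite subrK mulrC mulKf.
by field; rewrite h0 bw bh.
Unshelve. all: by end_near. Qed.

End RadialLimits.

(* Applied to the Clark measure itself ([tau = id], [omega = 1]) and to the
   integral along a branch of the level set ([tau z = (z, g j z)]). *)
Section Functional.
Context {R : realType} {d : measure_display} {X : measurableType d}.
Context (nu : {measure set X -> \bar R}) (D : set X).
Context (tau : X -> R[i] * R[i]) (omega : X -> R).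
Context (mD : measurable D) (tauD : forall x, D x -> torus (tau x)).
Context (omega0 : forall x, D x -> 0 <= omega x).
Local Notation I f := (\int[nu]_(x in D) (f (tau x) * omega x)).
Context (iomega : nu.-integrable D (EFin \o omega)).
Context (iker : forall a b, normc a < 1 -> normc b < 1 ->
  nu.-integrable D (EFin \o (fun x => poisson (a, b) (tau x) * omega x))).

Lemma integrableZ_EFin (c : R) (h : X -> R) : nu.-integrable D (EFin \o h) ->
  nu.-integrable D (EFin \o (fun x => c * h x)).
Proof.
move=> ih; apply: (eq_integrable mD (fun z => c%:E * (EFin \o h) z)%E) => //.
exact: integrableZl.
Qed.

Lemma integrable_sum_EFin (J : eqType) (s : seq J) (h : J -> X -> R) :
  (forall j, j \in s -> nu.-integrable D (EFin \o h j)) ->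
  nu.-integrable D (EFin \o (fun x => \sum_(j <- s) h j x)) /\
  \int[nu]_(x in D) (\sum_(j <- s) h j x) = \sum_(j <- s) \int[nu]_(x in D) h j
    x.
Proof.
elim: s => [|j s IH] ih.
  have E : (fun x => \sum_(j <- [::]) h j x) = cst 0.
    by apply/funext => x; rewrite big_nil.
  rewrite E big_nil; split; first exact: integrable0.
  by rewrite Rintegral_cst// mul0r.
have [] := IH (fun k ks => ih k (mem_behead (s := j :: s) ks)) => is_ Is.
have ij := ih j (mem_head _ _).
have E : (fun x => \sum_(k <- j :: s) h k x) = (fun x =>
  h j x + \sum_(k <- s) h k x).
  by apply/funext => x; rewrite big_cons.
rewrite E big_cons -Is; split; last by rewrite RintegralD.
pose g x := \sum_(k <- s) h k x.
apply: (eq_integrable mD (fun x => (EFin \o h j) x + (EFin \o g) x)%E) => //.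
exact: integrableD.
Qed.

Definition kernel_sum (s : seq R[i]) (c : R[i] -> R[i] ->
  R) (z : R[i] * R[i]) : R :=
  \sum_(a <- s) \sum_(b <- s) c a b * (pker a z.1 * pker b z.2).

Lemma kernel_sum_integral s c : all (fun a => normc a < 1) s ->
  nu.-integrable D (EFin \o (fun x => kernel_sum s c (tau x) * omega x)) /\
  I (kernel_sum s c) = \sum_(a <- s) \sum_(b <- s) c a b * I (poisson (a, b)).
Proof.
move=> /allP s1.
have E : (fun x => kernel_sum s c (tau x) * omega x) =
    (fun x => \sum_(a <- s) \sum_(b <- s) c a b * (poisson (a,
      b) (tau x) * omega x)).
  apply/funext => x; rewrite /kernel_sum mulr_suml; apply: eq_bigr => a _.
  by rewrite mulr_suml; apply: eq_bigr => b _; rewrite mulrA.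
rewrite E.
have H a : a \in s ->
  nu.-integrable D (EFin \o (fun x => \sum_(b <- s) c a b * (poisson (a,
    b) (tau x) * omega x))) /\
  \int[nu]_(x in D) (\sum_(b <- s) c a b * (poisson (a, b) (tau x) * omega x)) =
  \sum_(b <- s) c a b * I (poisson (a, b)).
  move=> as1; have [i1 i2] := @integrable_sum_EFin _ s
    (fun b x => c a b * (poisson (a, b) (tau x) * omega x))
    (fun b bs => integrableZ_EFin (c a b) (iker (s1 a as1) (s1 b bs))).
  split=> //; rewrite i2; apply: eq_big_seq => b bs.
  by rewrite RintegralZl//; exact: iker (s1 a as1) (s1 b bs).
have [i1 i2] := integrable_sum_EFin (fun a as1 => proj1 (H a as1)).
split=> //; rewrite i2; apply: eq_big_seq => a as1.
by case: (H a as1).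
Qed.

(** The map [tau] is not assumed measurable, so measurability of the integrand is obtained from the
    kernels: it is a pointwise limit of kernel sums, which are integrable. Domination is by a
    multiple of [omega]. *)
Lemma continuous_integrable (f : R[i] * R[i] -> R) : {within torus,
  continuous f} ->
  nu.-integrable D (EFin \o (fun x => f (tau x) * omega x)).
Proof.
move=> fc.
have /choice[sc Hsc] : forall k : nat, exists sc : seq R[i] * (R[i] -> R[i] ->
  R),
    all (fun a => normc a < 1) sc.1 /\ forall z : R[i] * R[i], torus z ->
      `|f z - kernel_sum sc.1 sc.2 z| <= k.+1%:R^-1.
  move=> k; have k0 : 0 < k.+1%:R^-1 :> R by rewrite invr_gt0.
  by have [s [c [s1 sc]]] := poisson_approximation fc k0; exists (s, c).
have [M M0 fM] := torus_bounded fc.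
have mf : measurable_fun D (fun x => f (tau x) * omega x).
  apply: (@measurable_fun_cvg _ _ _ _ (fun k x =>
    kernel_sum (sc k).1 (sc k).2 (tau x) * omega x)).
    move=> k; have [s1 _] := Hsc k; have [/measurable_int + _] :=
      kernel_sum_integral (sc k).2 s1.
    by move/measurable_EFinP.
  move=> x Dx; apply: cvgM; last exact: cvg_cst.
  apply/cvgrPdist_le => e e0.
  have [N _ HN] := near_infty_natSinv_lt (PosNum e0).
  exists N => // k /= Nk; have [_ H] := Hsc k.
  exact: le_trans (H _ (tauD Dx)) (ltW (HN k Nk)).
apply: (le_integrable mD _ _ (integrableZ_EFin M iomega)).
  exact/measurable_EFinP.
move=> x Dx /=; rewrite lee_fin !normrM (ger0_norm M0) ler_wpM2r//.
by apply: fM; exact: tauD.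
Qed.

Lemma kernel_sum_approx (f : R[i] * R[i] -> R) s c (e : R) : {within torus,
  continuous f} ->
  all (fun a => normc a < 1) s ->
  (forall z, torus z -> `|f z - kernel_sum s c z| <= e) ->
  `|I f - \sum_(a <- s) \sum_(b <- s) c a b * I (poisson (a, b))| <=
    e * \int[nu]_(x in D) omega x.
Proof.
move=> fc s1 He; have [iS IS] := kernel_sum_integral c s1.
have If := continuous_integrable fc.
rewrite -IS -RintegralB//.
have iB : nu.-integrable D (EFin \o (fun x => f (tau x) * omega x - kernel_sum s
  c (tau x) * omega x)).
  exact: (integrableB mD If iS).
rewrite (le_trans (le_normr_Rintegral mD iB))// -RintegralZl//.
apply: le_Rintegral => //.
- exact: integrable_norm.
- exact: integrableZ_EFin.
move=> x Dx; rewrite -mulrBl normrM (ger0_norm (omega0 Dx)) ler_wpM2r ?omega0//.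
by apply: He; exact: tauD.
Qed.

End Functional.

Lemma measurable_poisson {R : realType} (z w : R[i]) :
  normc z < 1 -> normc w < 1 -> measurable_fun torus (poisson (z, w)).
Proof.
move=> z1 w1; have mT := @measurable_unit_circle R.
have mpker (v : R[i]) : normc v < 1 -> measurable_fun unit_circle (pker v).
  by move=> v1; apply: within_continuous_measurable => //; exact: pker_within.
have m1 : measurable_fun torus (pker z \o (@fst R[i] R[i])).
  apply: (measurable_comp mT); first by move=> _ [x [x1 _] <-].
    exact: mpker.
  exact: (measurable_funTS measurable_fst).
have m2 : measurable_fun torus (pker w \o (@snd R[i] R[i])).
  apply: (measurable_comp mT); first by move=> _ [x [_ x2] <-].
    exact: mpker.
  exact: (measurable_funTS measurable_snd).
exact: (measurable_funM m1 m2).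
Qed.

(** * Level sets of rational inner functions *)

Section RationalInner.
Context {R : realType} (m n : nat) (p : {poly {poly R[i]}}) (alpha : R[i]).
Context (m0 : (0 < m)%N) (n0 : (0 < n)%N) (dp : bidegree_denominator m n p).
Context (alpha1 : normc alpha = 1).
Implicit Types (z w v : R[i]).
Local Notation phi := (rif m n p).
Local Notation refl := (reflection m n p).

Lemma horner2_eval (q : {poly {poly R[i]}}) z w :
  q.[z%:P].[w] = (map_poly (horner_eval w) q).[z].
Proof. by rewrite -horner_swapXY horner2_swapXY. Qed.

Lemma bidiskP z w : bidisk (z, w) <-> normc z < 1 /\ normc w < 1.
Proof. by rewrite /bidisk /unit_disk /= -!normc_lt1. Qed.

Lemma den_bidisk z w : normc z < 1 -> normc w < 1 -> p.[z%:P].[w] != 0.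
Proof. by move=> z1 w1; apply: (denominator_neq0 dp (z := (z, w)));
  apply/bidiskP. Qed.

Lemma den_size z : (size p.[z%:P] <= n.+1)%N.
Proof. by rewrite -(denominator_degree2 dp) max_size_evalC. Qed.

Lemma den_horner_neq0 z : normc z = 1 -> p.[z%:P] != 0.
Proof.
by apply: horner_denominator_neq0; [exact: denominator_degree1 dp|exact:
  denominator_reduced dp].
Qed.

Lemma continuous_normc_eval (q : {poly {poly R[i]}}) w :
  continuous (fun z => normc q.[z%:P].[w]).
Proof.
move=> z; rewrite (_ : (fun _ => _) = (fun z =>
  normc (map_poly (horner_eval w) q).[z])).
  apply: (@continuous_comp _ _ _ (horner (map_poly (horner_eval w) q)) (@normc
    R)).
    exact: continuous_hornerC.
  exact: continuous_normc.
by apply/funext => x; rewrite horner2_eval.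
Qed.

(** [zero_free_disk_lower_bound] compares [p(x, w)] with [p(x, v)] uniformly for [x] in the disk,
    and the comparison survives as [x] tends radially to [z]. The point [v] is chosen on the circle
    with [p(z, v)] nonzero. *)
Lemma den_circle_disk z w : normc z = 1 -> normc w < 1 -> p.[z%:P].[w] != 0.
Proof.
move=> z1 w1; have [s [_ _ rs]] := factor_roots (den_horner_neq0 z1).
have [v v1 vs] := exists_unitc_notin s; rewrite -rs in vs.
pose c := ((1 - normc w) / 2) ^+ n.
have c0 : 0 < c by rewrite exprn_gt0// divr_gt0// subr_gt0.
have := @radial_le R (fun z => c * normc p.[z%:P].[v]) (fun z =>
  normc p.[z%:P].[w]) z.
move=> /(_ _ _ z1 _) H.
rewrite -normc_gt0; apply: (@lt_le_trans _ _ (c * normc p.[z%:P].[v])).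
  by rewrite mulr_gt0// normc_gt0.
apply: H.
- by apply: cvgM; [exact: cvg_cst|exact: continuous_normc_eval].
- exact: continuous_normc_eval.
- move=> x x1; apply: zero_free_disk_lower_bound => //.
  + apply: contraNneq (den_bidisk x1 w1) => ->; by rewrite horner0.
  + exact: den_size.
  + by move=> y; exact: den_bidisk.
  + by rewrite v1.
Qed.

Lemma refl_horner z : normc z = 1 -> refl.[z%:P] =
  z ^+ m *: rev_poly n p.[z%:P].
Proof. by apply: reflection_horner; rewrite (denominator_degree1 dp). Qed.

Lemma den_circle_zeros : exists E : seq R[i], forall z, normc z = 1 ->
  z \notin E ->
  forall w, normc w <= 1 -> p.[z%:P].[w] != 0.
Proof.
have [E HE] := torus_zeros_finite m0 (denominator_degree1 dp)
  (denominator_degree2 dp) den_bidisk (denominator_reduced dp).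
exists E => z z1 zE w; rewrite le_eqVlt => /orP[/eqP w1|].
  by apply: contra zE => /eqP; exact: HE.
exact: den_circle_disk.
Qed.

(** A maximum principle: attaining the unimodular value [alpha] inside the disk forces the slice
    into the second case of [rev_dichotomy], where it is constant, and [z] then makes [alpha]
    exceptional. *)
Lemma rif_neq_circle z w : generic phi alpha -> normc z = 1 -> normc w < 1 ->
  phi (z, w) != alpha.
Proof.
move=> gen z1 w1; apply/eqP => pw.
have q0 := den_horner_neq0 z1.
have pn0 := den_circle_disk z1 w1.
have [H|[lambda l1 E]] := rev_dichotomy q0 (den_size z) (fun w =>
  den_circle_disk z1).
  have := H w w1.
  have : normc refl.[z%:P].[w] = normc p.[z%:P].[w].
    by rewrite -[refl.[_].[w]](divfK pn0) normcM -/(phi (z, w)) pw alpha1 mul1r.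
  rewrite refl_horner// hornerZ normcM normcX z1 expr1n mul1r => ->.
  by rewrite ltxx.
apply: gen; exists z; first exact/normc_eq1.
left => v v1; have vn0 : p.[z%:P].[v] != 0 by rewrite den_circle_disk//
  normc_lt1.
have phiE x : p.[z%:P].[x] != 0 -> phi (z, x) = z ^+ m * lambda.
  by move=> x0; rewrite /rif /= refl_horner// E !hornerZ mulrA mulfK.
by rewrite phiE// -pw phiE.
Qed.

(* If [phi] takes the value [alpha], where the quotient defining the Clark
   measure is [0 / 0 = 0], then [sigma] is zero, so [phi] is unimodular on the
   bidisk, contradicting the strict inequality of [rev_lt] on a slice. *)
Lemma rif_neq_bidisk sigma z w : clark_measure phi alpha sigma ->
  normc z < 1 -> normc w < 1 -> phi (z, w) != alpha.
Proof.
move=> [s0 cl] z1 w1; apply/eqP => pzw.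
have mT := @measurable_torus R.
have I0 : (\int[sigma]_(x in torus) (poisson (z, w) x)%:E = 0)%E.
  have /bidiskP/cl <- : normc z < 1 /\ normc w < 1 by [].
  by rewrite pzw subrr normc0 expr0n invr0 mulr0.
have sT : sigma torus = 0%E.
  (* A lower bound for the Poisson kernel on the torus, where [|x - v| <= 2]; with it a vanishing
     Poisson integral forces a vanishing mass. *)
  pose c : R := (1 - normc z ^+ 2) / 4 * ((1 - normc w ^+ 2) / 4).
  have sq1 v : normc v < 1 -> 0 < 1 - normc v ^+ 2.
    by move=> v1; rewrite subr_gt0 expr_lt1 ?normc_ge0.
  have c0 : 0 < c by rewrite mulr_gt0// divr_gt0// sq1.
  have bd v x : normc v < 1 -> normc x = 1 -> (1 - normc v ^+ 2) / 4 <=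
    pker v x.
    move=> v1 x1; rewrite /pker ler_wpM2l ?(ltW (sq1 _ v1))//.
    have d0 : 0 < normc (x - v) by rewrite normc_gt0 unitc_sub_neq0.
    rewrite lef_pV2 ?posrE ?exprn_gt0//.
    have : normc (x - v) <= 2.
      by rewrite (le_trans (le_normcD _ _))// normcN x1; lra.
    by move: (normc _) d0 => y y0 y2; nra.
  have : (c%:E * sigma torus <= 0)%E.
    rewrite -I0 -integral_cst//; apply: ge0_le_integral => //.
    - by move=> x _; rewrite lee_fin ltW.
    - apply/measurable_EFinP; exact: (measurable_poisson z1 w1).
    - move=> x [/normc_eq1 x1 /normc_eq1 x2]; rewrite lee_fin.
      by apply: ler_pM; rewrite ?bd// divr_ge0// ltW// sq1.
  by rewrite pmule_rle0 ?lte_fin// => H; apply/eqP; rewrite eq_le H measure_ge0.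
have unim x y : normc x < 1 -> normc y < 1 -> normc refl.[x%:P].[y] =
  normc p.[x%:P].[y].
  move=> x1 y1; have pn0 := den_bidisk x1 y1.
  have /bidiskP/cl : normc x < 1 /\ normc y < 1 by [].
  have mxy : measurable_fun torus (EFin \o poisson (x, y)).
    by apply/measurable_EFinP; exact: measurable_poisson.
  rewrite (null_set_integral mT mxy sT) => -[/eqP].
  have phiE : normc refl.[x%:P].[y] = normc (phi (x, y)) * normc p.[x%:P].[y].
    by rewrite -normcM /rif /= divfK.
  rewrite mulf_eq0 invr_eq0 sqrf_eq0 normc_eq0 => /orP[|].
    rewrite subr_eq0 eq_sym sqrf_eq1 => /orP[/eqP H|/eqP H].
      by rewrite phiE H mul1r.
    by have := normc_ge0 (phi (x, y)); rewrite H; lra.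
  by rewrite subr_eq0 => /eqP H; rewrite phiE -H alpha1 mul1r.
have [E HE] := den_circle_zeros.
(* Equality of moduli on the bidisk passes by radial limits to [(x, 0)], on a slice without zeros in
   the closed disk. *)
have [x x1 xE] := exists_unitc_notin E.
have := rev_lt n0 (den_size x) (HE x x1 xE) (_ : normc 0 < 1).
rewrite normc0 ltr01 => /(_ isT); apply/negP; rewrite -leNgt.
have -> : normc (rev_poly n p.[x%:P]).[0] = normc refl.[x%:P].[0].
  by rewrite refl_horner// hornerZ normcM normcX x1 expr1n mul1r.
apply: (@radial_le R (fun z => normc p.[z%:P].[0]) (fun z =>
  normc refl.[z%:P].[0])) => //.
- exact: continuous_normc_eval.
- exact: continuous_normc_eval.
- by move=> y y1; rewrite unim// normc0 ltr01.
Qed.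

End RationalInner.

(** * Slices, level sets and branches *)

Section Slices.
Context {R : realType} (m n : nat) (p : {poly {poly R[i]}}) (alpha : R[i]).
Context (m0 : (0 < m)%N) (n0 : (0 < n)%N) (dp : bidegree_denominator m n p).
Context (alpha1 : normc alpha = 1).
Implicit Types (z w v a : R[i]).
Local Notation phi := (rif m n p).
Local Notation refl := (reflection m n p).
Local Notation mu := (@circle_measure R).
Local Notation T := (@unit_circle R).

(** The real part of [(alpha + phi) / (alpha - phi)] with the denominator [p] cleared: for fixed [w]
    a quotient of polynomials in [z], the form that [poisson_frac] takes. *)
Definition herglotz z w : R :=
  complex.Re ((alpha * p.[z%:P].[w] + refl.[z%:P].[w]) /
              (alpha * p.[z%:P].[w] - refl.[z%:P].[w])).

Lemma rif_den z w : p.[z%:P].[w] != 0 ->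
  refl.[z%:P].[w] = phi (z, w) * p.[z%:P].[w].
Proof. by move=> p0; rewrite /rif /= divfK. Qed.

Lemma herglotzE z w : p.[z%:P].[w] != 0 -> herglotz z w =
  (1 - normc (phi (z, w)) ^+ 2) / normc (alpha - phi (z, w)) ^+ 2.
Proof.
move=> p0; rewrite /herglotz rif_den// -mulrDl -mulrBl.
by rewrite -mulf_div divff// mulr1 Re_cayley alpha1 expr1n.
Qed.

Section Poisson.
Context (gen : generic phi alpha).
Context (sigma : {measure set (R[i] * R[i]) ->
  \bar R}) (cl : clark_measure phi alpha sigma).

Lemma clark_den_neq0 z w : normc z <= 1 -> normc w < 1 ->
  alpha * p.[z%:P].[w] - refl.[z%:P].[w] != 0.
Proof.
rewrite le_eqVlt => /orP[/eqP|] z1 w1.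
  have p0 := den_circle_disk dp z1 w1.
  rewrite rif_den// -mulrBl mulf_neq0// subr_eq0 eq_sym.
  exact: rif_neq_circle.
have p0 := den_bidisk dp z1 w1.
rewrite rif_den// -mulrBl mulf_neq0// subr_eq0 eq_sym.
exact: rif_neq_bidisk cl _ _.
Qed.

Lemma herglotz_frac w : exists A B : {poly R[i]},
  (forall z, herglotz z w = complex.Re (A.[z] / B.[z])) /\
  (normc w < 1 -> forall z, normc z <= 1 -> B.[z] != 0).
Proof.
pose ev q := map_poly (horner_eval w) q.
exists (alpha *: ev p + ev refl), (alpha *: ev p - ev refl).
have E z : (alpha *: ev p - ev refl).[z] = alpha * p.[z%:P].[w] -
  refl.[z%:P].[w].
  by rewrite hornerD hornerN hornerZ -!horner2_eval.
split=> [z|w1 z z1]; last by rewrite E clark_den_neq0.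
by rewrite E hornerD hornerZ -!horner2_eval.
Qed.

Lemma herglotz_poisson z w : normc z < 1 -> normc w < 1 ->
  \int[mu]_(x in T) (pker z x * herglotz x w) = herglotz z w.
Proof.
move=> z1 w1; have [A [B [E B0]]] := herglotz_frac w.
rewrite E -(poisson_frac A (B0 w1) z1); apply: eq_Rintegral => x _.
by rewrite E.
Qed.

Lemma herglotz_bounded w : normc w < 1 ->
  exists2 M : R, 0 <= M & forall z, normc z = 1 -> `|herglotz z w| <= M.
Proof.
move=> w1; have [A [B [E B0]]] := herglotz_frac w.
have c : {within T, continuous (fun z => A.[z] / B.[z])}.
  by apply: within_continuous_frac => z /normc_eq1 z1; rewrite B0// z1.
have [M M0 HM] := within_circle_bounded (within_continuous_comp c
  (@continuous_Re R)).
by exists M => // z z1; rewrite E; exact: HM.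
Qed.

End Poisson.

(* Equal to [|d phi / d z2|] on the level set, but visibly continuous there. *)
Definition dy_den z w : R := n%:R -
  2 * complex.Re (w * (map_poly (@deriv R[i]) p).[z%:P].[w] / p.[z%:P].[w]).

Lemma deriv_horner_polyC (q : {poly {poly R[i]}}) z :
  (map_poly (@deriv R[i]) q).[z%:P] = (q.[z%:P])^`().
Proof.
rewrite (@horner_coef_wide _ (size q)); last exact: size_poly.
rewrite horner_coef raddf_sum; apply: eq_bigr => i _.
rewrite coef_map_id0 ?deriv0//.
by rewrite /= derivM -polyC_exp derivC mulr0 addr0.
Qed.

Lemma rif_slice z : normc z = 1 ->
  (forall w, normc w <= 1 -> p.[z%:P].[w] != 0) ->
  exists rs : seq R[i], [/\ uniq rs, size rs = n,
    forall a, a \in rs <-> (normc a = 1 /\ phi (z, a) = alpha),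
    forall a, a \in rs ->
      normc (dz2 phi (z, a)) = dy_den z a /\ 0 < dy_den z a &
    forall w, normc w < 1 ->
      herglotz z w = \sum_(a <- rs) pker w a / normc (dz2 phi (z, a))].
Proof.
move=> z1 pz; have sz := den_size dp z.
set q := p.[z%:P] in pz sz.
(* The slice of the reflection is [z ^+ m] times the reversed slice of [p]; dividing [alpha] by this
   unimodular factor reduces the level set equation to [clark_poly]. *)
pose beta := alpha / z ^+ m.
have zm0 : z ^+ m != 0 by rewrite expf_neq0// unitc_neq0.
have zm1 : normc (z ^+ m) = 1 by rewrite normcX z1 expr1n.
have beta1 : normc beta = 1 by rewrite normcM normcV zm1 alpha1 invr1 mulr1.
have az : alpha = beta * z ^+ m by rewrite divfK.
have rz w : refl.[z%:P].[w] = z ^+ m * (rev_poly n q).[w].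
  by rewrite (refl_horner dp z1) hornerZ.
have [rs [urs srs rrs]] := clark_poly_roots n0 sz pz beta1.
have rtE a : normc a = 1 -> (phi (z, a) = alpha <->
  root (clark_poly n q beta) a).
  move=> a1; have qa : q.[a] != 0 by rewrite pz// a1.
  have -> : phi (z, a) = z ^+ m * (rev_poly n q).[a] / q.[a] by rewrite /rif /=
    rz.
  split=> [H|/rootP].
    apply/rootP; rewrite !hornerE; apply: (mulfI zm0).
    rewrite mulr0 mulrBr mulrA [z ^+ m * beta]mulrC -az -H divfK//.
    by rewrite subrr.
  rewrite !hornerE => /eqP; rewrite subr_eq0 => /eqP <-.
  by rewrite mulrA [z ^+ m * beta]mulrC -az mulfK.
have rs1 a : a \in rs -> normc a = 1.
  by rewrite -rrs; exact: (clark_poly_root n0 sz pz beta1).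
have wE a : a \in rs -> normc (dz2 phi (z, a)) = clark_weight n q a.
  move=> ars; have ra : root (clark_poly n q beta) a by rewrite rrs.
  have qa : q.[a] != 0 by rewrite pz// rs1.
  rewrite /dz2 /=.
  have -> : (fun w => phi (z, w)) = (fun w => (z ^+ m *: rev_poly n q).[w] /
    q.[w]).
    by apply/funext => w; rewrite /rif /= rz hornerZ.
  rewrite derive1_frac// derivZ !hornerZ -!mulrA -mulrBr -mulrA normcM zm1
    mul1r.
  exact: (clark_weightE n0 sz pz beta1 ra).
have dE a : dy_den z a = clark_weight n q a.
  by rewrite /dy_den /clark_weight deriv_horner_polyC.
exists rs; split=> //.
- move=> a; split=> [ars|[a1 pa]].
    by split; [exact: rs1|apply/(rtE a (rs1 a ars)); rewrite rrs].
  by rewrite -rrs; apply/rtE.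
- move=> a ars; rewrite wE// dE; split=> //.
  exact: (clark_weight_gt0 n0 sz pz (rs1 a ars)).
- move=> w w1.
  rewrite /herglotz rz {1 2}az -/q.
  have -> : (beta * z ^+ m * q.[w] + z ^+ m * (rev_poly n q).[w]) /
     (beta * z ^+ m * q.[w] - z ^+ m * (rev_poly n q).[w]) =
     (beta * q.[w] + (rev_poly n q).[w]) / (beta * q.[w] - (rev_poly n q).[w]).
    rewrite [beta * _]mulrC -!mulrA -mulrDr -mulrBr -mulf_div divff// mul1r.
    by [].
  rewrite (clark_identity n0 sz pz beta1 urs srs rrs w1).
  by apply: eq_big_seq => a /wE ->.
Qed.

Lemma continuous_rif z w : p.[z%:P].[w] != 0 -> {for (z, w), continuous phi}.
Proof.
move=> p0; apply: cvgM; first exact: (@continuous_horner2 R refl (z, w)).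
by apply: cvgV => //; exact: (@continuous_horner2 R p (z, w)).
Qed.

Lemma radial_cvg z w : (r%:C * z, r%:C * w) @[r --> (1 : R)^'-] --> (z, w).
Proof.
have H x : r%:C * x @[r --> (1 : R)^'-] --> x.
  apply: cvg_at_left_filter; rewrite -[X in _ --> X]mul1r.
  by apply: cvgM; [exact: continuous_RC|exact: cvg_cst].
exact: (cvg_pair (H z) (H w)).
Qed.

Lemma radial_rif z w : p.[z%:P].[w] != 0 ->
  phi (r%:C * z, r%:C * w) @[r --> (1 : R)^'-] --> phi (z, w).
Proof.
by move=> p0 P /(continuous_rif p0) NP; exact: (radial_cvg NP).
Qed.

(** The closure in [level_set] could add points that are no radial limit points themselves. Where
    [p] is nonzero [phi] is continuous, so it adds none. *)
Lemma level_set_slice z w : normc z = 1 -> normc w = 1 -> p.[z%:P].[w] != 0 ->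
  level_set phi alpha (z, w) <-> phi (z, w) = alpha.
Proof.
move=> z1 w1 p0; split=> [H|<-]; last first.
  apply: subset_closure; split; last exact: radial_rif.
  by split; exact/normc_eq1.
apply/eqP/negPn/negP => pa.
have c1 : {for (z, w), continuous (fun x : R[i] * R[i] =>
  normc p.[x.1%:P].[x.2])}.
  apply: (@continuous_comp _ _ _ (fun x : R[i] * R[i] =>
    p.[x.1%:P].[x.2]) (@normc R)).
    exact: continuous_horner2.
  exact: continuous_normc.
have c2 : {for (z, w), continuous (fun x => normc (phi x - alpha))}.
  apply: (@continuous_comp _ _ _ (fun x : R[i] * R[i] =>
    phi x - alpha) (@normc R)).
    by apply: cvgB; [exact: continuous_rif|exact: cvg_cst].
  exact: continuous_normc.
have d1 : 0 < normc p.[z%:P].[w] by rewrite normc_gt0.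
have d2 : 0 < normc (phi (z, w) - alpha) by rewrite normc_gt0 subr_eq0.
move/cvgrPdist_lt : c1 => /(_ _ d1) N1; move/cvgrPdist_lt : c2 => /(_ _ d2) N2.
have [[x y] [[Txy lim] [/= H1 H2]]] := H _ (filterI N1 N2).
have pxy : p.[x%:P].[y] != 0.
  by apply: contraTneq H1 => ->; rewrite normc0 subr0 ger0_norm ?normc_ge0//
    ltxx.
have : phi (x, y) = alpha.
  apply: (cvg_unique _ (radial_rif pxy) lim); exact: norm_hausdorff.
move=> E; move: H2; rewrite E subrr normc0 subr0 ger0_norm ?normc_ge0//.
by rewrite ltxx.
Qed.

(** Off the vertical lines, the [n] values [g j z] exhaust the [n] distinct solutions in the slice.
    By counting no value is repeated, so the sum over solutions becomes a sum over branches. *)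
Lemma parametrization_slice tau0 (g : 'I_n -> R[i] -> R[i]) :
  parametrization phi alpha tau0 g -> exists S : set R[i], finite_set S /\
    forall z, normc z = 1 -> ~ S z ->
      (forall w, normc w <= 1 -> p.[z%:P].[w] != 0) ->
    (forall w, normc w < 1 ->
      herglotz z w = \sum_(j < n) pker w (g j z) / normc (dz2 phi (z,
        g j z))) /\
    (forall j, normc (dz2 phi (z, g j z)) = dy_den z (g j z) /\ 0 < dy_den z (g
      j z)).
Proof.
move=> [t0 gT ga [S [fS ST] LE]]; exists S; split=> // z z1 Sz pz.
have [rs [urs srs rsE dE hE]] := rif_slice z1 pz.
have gT1 j : normc (g j z) = 1 by apply/normc_eq1; apply: gT; exact/normc_eq1.
have LEz w : normc w = 1 -> (level_set phi alpha (z, w) <-> exists j, w =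
  g j z).
  move=> w1; rewrite LE; split=> [[[_ //]|[/= /Sz//]]|[j wj]].
  by left; split=> /=; [exact/normc_eq1|exists j].
have grs j : g j z \in rs.
  apply/rsE; split=> //; apply/level_set_slice => //; first by rewrite pz// gT1.
  by apply/LEz => //; exists j.
have perm : perm_eq rs [seq g j z | j <- enum 'I_n].
  have sub : {subset rs <= [seq g j z | j <- enum 'I_n]}.
    move=> a /[dup] ars /rsE[a1 pa].
    have /LEz[//|j ->] : level_set phi alpha (z, a).
      by apply/level_set_slice => //; rewrite pz// a1.
    by apply: map_f; rewrite mem_enum.
  have ss : (size [seq g j z | j <- enum 'I_n] <= size rs)%N.
    by rewrite size_map size_enum_ord srs.
  apply: uniq_perm => //; first exact: leq_size_uniq urs sub ss.
  move=> a; apply/idP/idP; first exact: sub.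
  by move=> /mapP[j _ ->].
split=> [w w1|j]; last by exact: dE.
by rewrite hE// (perm_big _ perm)/= big_map big_enum.
Qed.

End Slices.

(** * The Clark measure *)

Section Assembly.
Context {R : realType}.
Implicit Types (z w v a b : R[i]).
Local Notation mu := (@circle_measure R).
Local Notation T := (@unit_circle R).

(** On the excluded finite set the branches and the derivative may take arbitrary values; as finite
    sets are measurable and null, neither measurability nor the integral is affected. *)
Lemma circle_integrable_off_finite (h : R[i] ->
  R) (F : set R[i]) : finite_set F ->
  mu.-integrable (T `\` F) (EFin \o h) ->
  mu.-integrable T (EFin \o h) /\
  \int[mu]_(z in T) h z = \int[mu]_(z in T `\` F) h z.
Proof.
move=> fF ih; have mT := @measurable_unit_circle R.
have mF := measurable_finite_plane fF; have F0 := circle_measure_finite0 fF.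
have mh : measurable_fun T h.
  apply: (measurable_fun_off_finite mT fF).
  by apply/measurable_EFinP; exact: measurable_int ih.
have iT : mu.-integrable T (EFin \o h).
  by apply/(negligible_integrable mF mT _ F0) => //; exact/measurable_EFinP.
by split=> //; rewrite /Rintegral (negligible_integral mF mT iT F0).
Qed.

Context (m n : nat) (p : {poly {poly R[i]}}) (alpha : R[i]).
Context (m0 : (0 < m)%N) (n0 : (0 < n)%N) (dp : bidegree_denominator m n p).
Context (alpha1 : normc alpha = 1).
Local Notation phi := (rif m n p).
Context (gen : generic phi alpha).
Context (sigma : {measure set (R[i] * R[i]) ->
  \bar R}) (cl : clark_measure phi alpha sigma).
Local Notation herg := (herglotz m n p alpha).

Lemma clark_herglotz a b : normc a < 1 -> normc b < 1 ->
  (\int[sigma]_(x in torus) (poisson (a, b) x)%:E = (herg a b)%:E)%E.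
Proof.
move=> a1 b1; case: cl => _ H; rewrite -H; last exact/bidiskP.
by rewrite (@herglotzE R m n p alpha alpha1 a b (den_bidisk dp a1 b1)).
Qed.

Lemma pker_bounded a : normc a < 1 -> exists2 M : R, 0 <= M &
  forall z, normc z = 1 -> `|pker a z| <= M.
Proof. by move=> a1; exact: within_circle_bounded (pker_within a1). Qed.

Lemma pker0 z : normc z = 1 -> pker 0 z = 1.
Proof. by move=> z1; rewrite /pker normc0 subr0 z1 expr1n expr0n subr0 divr1.
  Qed.

(** The Poisson kernel of the origin is 1 on the torus, so the total mass is [herg 0 0]. *)
Lemma clark_finite : (sigma torus < +oo)%E.
Proof.
have n01 : normc (0 : R[i]) < 1 by rewrite normc0.
have := clark_herglotz n01 n01.
rewrite (eq_integral (fun=> 1%E)); last first.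
  move=> [x y]; rewrite inE => -[/normc_eq1 x1 /normc_eq1 y1].
  by rewrite -[poisson _ _]/(pker 0 x * pker 0 y) !pker0// mulr1.
rewrite integral_cst ?mul1e; last exact: measurable_torus.
by move=> ->; rewrite ltry.
Qed.

Lemma clark_kernel_integrable a b : normc a < 1 -> normc b < 1 ->
  sigma.-integrable torus (EFin \o (fun x => poisson (a, b) x * 1)).
Proof.
move=> a1 b1; have mT := @measurable_torus R.
apply: measurable_bounded_integrable => //; first exact: clark_finite.
  by under eq_fun do rewrite mulr1; exact: measurable_poisson.
have [Ma Ma0 Ha] := pker_bounded a1; have [Mb Mb0 Hb] := pker_bounded b1.
exists (Ma * Mb); split; first exact: num_real.
move=> M MM [x y] [/normc_eq1 x1 /normc_eq1 y1]; apply: le_trans (ltW MM).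
rewrite mulr1 -[poisson _ _]/(pker a x * pker b y) normrM.
by apply: ler_pM; rewrite ?Ha ?Hb.
Qed.

Context (tau0 : R[i]) (g : 'I_n -> R[i] -> R[i]).
Context (par : parametrization phi alpha tau0 g).

Definition branch_weight (j : 'I_n) z : R := (normc (dz2 phi (z, g j z)))^-1.

(** [F] collects the first coordinates of the torus zeros of [p], those of the vertical lines, and
    the base point, where the branches may jump. *)
Lemma good_points : exists F : set R[i], [/\ finite_set F,
  forall j z, (T `\` F) z -> g j x @[x --> within T (nbhs z)] --> g j z,
  forall z, (T `\` F) z -> forall w, normc w <= 1 -> p.[z%:P].[w] != 0,
  forall z w, (T `\` F) z -> normc w < 1 ->
    herg z w = \sum_(j < n) pker w (g j z) * branch_weight j z &
  forall j z, (T `\` F) z -> branch_weight j z = (dy_den n p z (g j z))^-1 /\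
    0 < dy_den n p z (g j z)].
Proof.
have [E HE] := den_circle_zeros m0 dp.
have [S [fS HS]] := parametrization_slice n0 dp alpha1 par.
exists ([set` E] `|` S `|` [set tau0]); split.
- rewrite !finite_setU; split; last exact: finite_set1.
  by split=> //; apply/finite_seqP; exists E.
- move=> j z [Tz /= nF]; apply: circle_analytic_continuous => //.
  by apply: (param_analytic par) => //; apply/eqP => zt; apply: nF; right.
- move=> z [/normc_eq1 z1 /= nF]; apply: HE => //.
  by apply/negP => zE; apply: nF; left; left.
- move=> z w [/normc_eq1 z1 /= nF] w1.
  have [|H _] := HS z z1 (fun Sz => nF (or_introl (or_intror Sz))).
    by apply: HE => //; apply/negP => zE; apply: nF; left; left.
  exact: H.
- move=> j z [/normc_eq1 z1 /= nF].
  have [|_ H] := HS z z1 (fun Sz => nF (or_introl (or_intror Sz))).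
    by apply: HE => //; apply/negP => zE; apply: nF; left; left.
  by rewrite /branch_weight; have [-> d0] := H j.
Qed.

Lemma continuous_dy_den z w : p.[z%:P].[w] != 0 ->
  {for (z, w), continuous (fun x : R[i] * R[i] => dy_den n p x.1 x.2)}.
Proof.
move=> p0; apply: cvgB; first exact: cvg_cst.
apply: cvgM; first exact: cvg_cst.
apply: (@continuous_comp _ _ _ (fun x : R[i] * R[i] => x.2 *
  (map_poly (@deriv R[i]) p).[x.1%:P].[x.2] / p.[x.1%:P].[x.2]) (@complex.Re
    R)).
  apply: cvgM; last by apply: cvgV => //; exact: (@continuous_horner2 R p (z,
    w)).
  apply: cvgM; first exact: cvg_snd.
  exact: (@continuous_horner2 R _ (z, w)).
exact: continuous_Re.
Qed.

Lemma branch_kernel_integrable (F : set R[i]) j a b : finite_set F ->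
  (forall j z, (T `\` F) z -> g j x @[x --> within T (nbhs z)] --> g j z) ->
  (forall z, (T `\` F) z -> forall w, normc w <= 1 -> p.[z%:P].[w] != 0) ->
  (forall z w, (T `\` F) z -> normc w < 1 ->
    herg z w = \sum_(j < n) pker w (g j z) * branch_weight j z) ->
  (forall j z, (T `\` F) z -> branch_weight j z = (dy_den n p z (g j z))^-1 /\
    0 < dy_den n p z (g j z)) ->
  normc a < 1 -> normc b < 1 ->
  mu.-integrable (T `\` F) (EFin \o (fun z => poisson (a, b) (z,
    g j z) * branch_weight j z)).
Proof.
move=> fF gc pF hF dF a1 b1.
have mT := @measurable_unit_circle R; have mF := measurable_finite_plane fF.
have mG : measurable (T `\` F) by exact: measurableD.
have gT z : T z -> normc (g j z) = 1.
  by move=> Tz; apply/normc_eq1; exact: param_circle par _ _ _.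
have n01 : normc (0 : R[i]) < 1 by rewrite normc0.
have [M M0 HM] := herglotz_bounded m0 n0 dp alpha1 gen cl n01.
have [Ma Ma0 Ha] := pker_bounded a1; have [Mb Mb0 Hb] := pker_bounded b1.
apply: measurable_bounded_integrable => //.
- rewrite (@le_lt_trans _ _ (mu T))//; last by rewrite [X in (X <
    _)%E]circle_measure1 ltry.
  by apply: le_measure; rewrite ?inE//; exact: subDsetl.
(* With [dy_den] in place of the derivative the integrand is continuous along the branch off [F]. *)
- apply: (@eq_measurable_fun _ _ _ _ _ (fun z =>
    pker a z * pker b (g j z) * (dy_den n p z (g j z))^-1)).
    by move=> z; rewrite inE => Gz; have [-> _] := dF j z Gz.
  apply: within_continuous_measurable => //.
  apply/subspace_continuousP => z Gz; have [Tz _] := Gz.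
  have [_ d0] := dF j z Gz.
  have z1 : normc z = 1 by apply/normc_eq1.
  have gw : g j x @[x --> within (T `\` F) (nbhs z)] --> g j z.
    move=> P /(gc j z Gz) H; have {}H : nbhs z [set x | T x -> P (g j x)] := H.
    suff : nbhs z [set x | (T `\` F) x -> P (g j x)] by [].
    by apply: filterS H => x Hx [Tx _]; exact: Hx.
  have idw : x @[x --> within (T `\` F) (nbhs z)] --> z.
    by apply: cvg_within_filter; exact: cvg_id.
  apply: cvgM; first apply: cvgM.
  + by apply: cvg_within_filter; exact: continuous_pker.
  + by apply: cvg_comp gw _; exact: continuous_pker b1 (gT _ Tz).
  + apply: cvgV; first by rewrite gt_eqF.
    have p0 : p.[z%:P].[g j z] != 0 by rewrite pF// gT.
    by move=> P /(continuous_dy_den p0) NP; exact: (cvg_pair idw gw NP).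
- exists (Ma * Mb * M); split; first exact: num_real.
  move=> K MK z Gz; apply: le_trans (ltW MK); have [Tz _] := Gz.
  have z1 : normc z = 1 by apply/normc_eq1.
  have bw0 i : 0 <= branch_weight i z by rewrite invr_ge0 normc_ge0.
  rewrite -[poisson _ _]/(pker a z * pker b (g j z)) normrM [`|pker _ _ *
    _|]normrM.
  have H1 : `|pker a z| * `|pker b (g j z)| <= Ma * Mb.
    by apply: ler_pM => //; [exact: Ha|exact: Hb (gT _ Tz)].
  apply: ler_pM => //.
  (* At [w = 0] all kernels are 1, so [herg z 0] is the sum of the nonnegative weights and dominates
     each of them. *)
  rewrite ger0_norm// (le_trans _ (HM z z1))// (hF z 0 Gz n01).
  rewrite ger0_norm; last by rewrite sumr_ge0// => i _;
    rewrite mulr_ge0// pker_ge0.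
  rewrite (bigD1 j)//= pker0 ?gT// mul1r lerDl sumr_ge0// => i _.
  by rewrite mulr_ge0// pker_ge0.
Qed.

Lemma clark_real_formula (f : R[i] * R[i] -> R) : {within torus,
  continuous f} ->
  (forall j, mu.-integrable T (EFin \o (fun z => f (z,
    g j z) * branch_weight j z))) /\
  \int[sigma]_(x in torus) f x =
  \sum_(j < n) \int[mu]_(z in T) (f (z, g j z) * branch_weight j z).
Proof.
move=> fc; have [F [fF gc pF hF dF]] := good_points.
have mT := @measurable_unit_circle R; have mF := measurable_finite_plane fF.
pose G := T `\` F; have mG : measurable G by exact: measurableD.
have gT j z : G z -> torus (z, g j z).
  by move=> [Tz _]; split=> //; exact: param_circle par _ _ _.
have n01 : normc (0 : R[i]) < 1 by rewrite normc0.
have bw0 j z : G z -> 0 <= branch_weight j z by rewrite invr_ge0 normc_ge0.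
have ik j a b (a1 : normc a < 1) (b1 : normc b < 1) :=
  branch_kernel_integrable j fF gc pF hF dF a1 b1.
have io j : mu.-integrable G (EFin \o branch_weight j).
  apply: eq_integrable (ik j 0 0 n01 n01) => // z; rewrite inE => Gz /=.
  have [/normc_eq1 z1 /normc_eq1 w1] := gT j z Gz.
  by rewrite -[poisson _ _]/(pker 0 z * pker 0 (g j z)) !pker0// !mul1r.
have sik := clark_kernel_integrable.
have so : sigma.-integrable torus (EFin \o cst (1 : R)).
  apply: eq_integrable (sik 0 0 n01 n01); first exact: measurable_torus.
  move=> [x y]; rewrite inE => -[/normc_eq1 x1 /normc_eq1 y1] /=.
  by rewrite -[poisson _ _]/(pker 0 x * pker 0 y) !pker0// !mul1r.
have ifG j := continuous_integrable mG (gT j) (io j) (ik j) fc.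
have ifT j := circle_integrable_off_finite fF (ifG j).
split=> [j|]; first by have [] := ifT j.
under eq_bigr do rewrite (proj2 (ifT _)).
rewrite -/G.
(* Both sides equal [herg a b]: the left one by the definition of the Clark measure, the right one
   by the slice formula at [b] and then the Poisson formula in the first variable. *)
have kerE a b : normc a < 1 -> normc b < 1 ->
    \int[sigma]_(x in torus) (poisson (a, b) x * 1) =
    \sum_(j < n) \int[mu]_(z in G) (poisson (a, b) (z,
      g j z) * branch_weight j z).
  move=> a1 b1; transitivity (herg a b).
    rewrite /Rintegral; under eq_integral do rewrite mulr1.
    by rewrite clark_herglotz.
  have [iS <-] := integrable_sum_EFin mG (s := index_enum 'I_n) (fun j _ =>
    ik j a b a1 b1).
  have E z : G z -> \sum_(j < n) poisson (a, b) (z, g j z) * branch_weight j z =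
      pker a z * herg z b.
    move=> Gz; rewrite (hF z b Gz b1) mulr_sumr; apply: eq_bigr => j _.
    by rewrite mulrA.
  have iH : mu.-integrable G (EFin \o (fun z => pker a z * herg z b)).
    by apply: eq_integrable iS => // z; rewrite inE => Gz /=; rewrite E.
  rewrite -(herglotz_poisson m0 n0 dp alpha1 gen cl a1 b1).
  rewrite (proj2 (circle_integrable_off_finite fF iH)).
  by apply: eq_Rintegral => z; rewrite inE => Gz; rewrite E.
(* The sum of the masses of the two functionals bounds their difference in the supremum norm;
   [K + 1] keeps the quotient below meaningful when [K = 0]. *)
pose K := \int[sigma]_(x in torus) (1 : R) + \sum_(j < n) \int[mu]_(z in G)
  branch_weight j z.
have K0 : 0 <= K.
  rewrite addr_ge0 ?Rintegral_ge0// sumr_ge0// => j _.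
  by apply: Rintegral_ge0 => z; exact: bw0.
apply/eqP; rewrite -subr_eq0 -normr_eq0 eq_le normr_ge0 andbT.
apply/ler_addgt0Pl => e e0; rewrite addr0.
have K10 : 0 < K + 1 by rewrite ltr_wpDl.
have e10 : 0 < e / (K + 1) by rewrite divr_gt0.
have [s [c [s1 sc]]] := poisson_approximation fc e10.
have A1 := kernel_sum_approx (@measurable_torus R) (fun x Tx => Tx)
  (fun x _ => ler01) so sik fc s1 sc.
have A2 j := kernel_sum_approx mG (gT j) (bw0 j) (io j) (ik j) fc s1 sc.
rewrite /= in A1 A2.
under eq_Rintegral do rewrite -[f _]mulr1.
set I := Rintegral _ _ _ in A1 *.
have -> : I - \sum_(j < n) \int[mu]_(z in G) (f (z,
  g j z) * branch_weight j z) =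
   (I - \sum_(a <- s) \sum_(b <- s) c a b * \int[sigma]_(x in torus) (poisson
     (a, b) x * 1)) -
   \sum_(j < n) (\int[mu]_(z in G) (f (z, g j z) * branch_weight j z) -
     \sum_(a <- s) \sum_(b <- s) c a b *
       \int[mu]_(z in G) (poisson (a, b) (z, g j z) * branch_weight j z)).
  rewrite sumrB.
  have -> : \sum_(j < n) \sum_(a <- s) \sum_(b <- s) c a b *
      \int[mu]_(z in G) (poisson (a, b) (z, g j z) * branch_weight j z) =
    \sum_(a <- s) \sum_(b <- s) c a b * \int[sigma]_(x in torus) (poisson (a,
      b) x * 1).
    rewrite exchange_big; apply: eq_big_seq => a as1 /=.
    rewrite exchange_big; apply: eq_big_seq => b bs1 /=.
    by rewrite -mulr_sumr kerE//; [exact: (allP s1)|exact: (allP s1)].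
  by rewrite opprB addrA subrK.
apply: (@le_trans _ _ (e / (K + 1) * K)).
  rewrite (le_trans (ler_normB _ _))// /K mulrDr lerD//.
  rewrite mulr_sumr (le_trans (ler_norm_sum _ _ _))//.
  by apply: ler_sum => j _; exact: A2.
rewrite mulrAC ler_pdivrMr//; apply: ler_wpM2l; first exact: ltW.
by rewrite lerDl.
Qed.

End Assembly.

Theorem theorem3p3 (R : realType) (m n : nat) (p : {poly {poly R[i]}})
    (alpha : R[i]) (sigma : {measure set (R[i] * R[i]) -> \bar R})
    (tau0 : R[i]) (g : 'I_n -> R[i] -> R[i]) (f : R[i] * R[i] -> R[i]) :
  (0 < m)%N -> (0 < n)%N ->
  bidegree_denominator m n p ->
  rational_inner (rif m n p) ->
  unit_circle alpha ->
  generic (rif m n p) alpha ->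
  clark_measure (rif m n p) alpha sigma ->
  parametrization (rif m n p) alpha tau0 g ->
  {within torus, continuous f} ->
  (forall j : 'I_n, cintegrable circle_measure unit_circle
     (fun zeta => f (zeta, g j zeta) / `|dz2 (rif m n p) (zeta, g j zeta)|)) /\
  cintegral sigma torus f =
  \sum_(j < n) cintegral circle_measure unit_circle
    (fun zeta => f (zeta, g j zeta) / `|dz2 (rif m n p) (zeta, g j zeta)|).
Proof.
move=> m0 n0 dp _ /normc_eq1 alpha1 gen cl par fc.
have fRe : {within torus, continuous (fun x => complex.Re (f x))}.
  move=> x; exact: (@continuous_comp (subspace torus) _ _ f (@complex.Re R) x
    (fc x) (@continuous_Re R _)).
have fIm : {within torus, continuous (fun x => complex.Im (f x))}.
  move=> x; exact: (@continuous_comp (subspace torus) _ _ f (@complex.Im R) x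
    (fc x) (@continuous_Im R _)).
have [iRe eRe] := clark_real_formula m0 n0 dp alpha1 gen cl par fRe.
have [iIm eIm] := clark_real_formula m0 n0 dp alpha1 gen cl par fIm.
(* The weight is real, so real and imaginary parts separate and the real formula applies to each. *)
have E j z : f (z, g j z) / `|dz2 (rif m n p) (z, g j z)| =
    (complex.Re (f (z, g j z)) * branch_weight m p g j z) +i*
    (complex.Im (f (z, g j z)) * branch_weight m p g j z).
  rewrite normCE -fmorphV /= -/(branch_weight m p g j z).
  by case: (f _) => x y; move: (branch_weight _ _ _ _) => k; simpc.
split=> [j|].
  by split; under eq_fun do rewrite E /=; [exact: iRe|exact: iIm].
rewrite [LHS]/cintegral eRe eIm.
transitivity (\sum_(j < n) ((\int[circle_measure]_(z in unit_circle)
    (complex.Re (f (z, g j z)) * branch_weight m p g j z)) +i*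
   (\int[circle_measure]_(z in unit_circle)
    (complex.Im (f (z, g j z)) * branch_weight m p g j z)))).
  apply/eqP; rewrite eq_complex !raddf_sum /=; apply/andP; split; apply/eqP;
    exact: eq_bigr.
apply: eq_bigr => j _; congr (_ +i* _); apply: eq_Rintegral => z _;
  by rewrite E.
Qed.
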